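(* Let $n\ge 1$ and let $n_1,n_2$ be integers with $0\le n_2<n_1\le n$. Let $u:\mathbb{R}^n\to\mathbb{R}$ be a smooth strictly convex function satisfying, for all $x\in\mathbb{R}^n$, $$\ln q_{n_1,n_2}\left(D^2u(x)\right)=\frac{1}{2}\,x\cdot Du(x)-u(x).$$ Then $u$ is quadratic.
   Context: For a real symmetric $n\times n$ matrix $\mathcal{B}$ with eigenvalues $\lambda_1,\dots,\lambda_n$, $\sigma_l(\mathcal{B})=\sum_{i_1<\dots<i_l}\lambda_{i_1}\cdots\lambda_{i_l}$ for $1\le l\le n$ and $\sigma_0(\mathcal{B})=1$. The matrix $\mathcal{B}$ is called $k$-positive if $\sigma_l(\mathcal{B})>0$ for all $0\le l\le k$. For $0\le n_2<n_1\le n$ and an $n_1$-positive matrix $\mathcal{B}$, $q_{n_1,n_2}(\mathcal{B})=\sigma_{n_1}(\mathcal{B})/\sigma_{n_2}(\mathcal{B})$. $Du$ is the gradient and $D^2u$ the Hessian matrix of $u$. A smooth function $u$ is strictly convex if $D^2u(x)$ is positive-definite at every point $x$. ''Quadratic'' means that $u$ is a polynomial of degree at most $2$ in $x_1,\dots,x_n$. *)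

(* Defs.v *)
From HB Require Import structures.
From mathcomp Require Import all_boot all_order all_algebra.
From mathcomp Require Import all_classical all_reals all_analysis.
(* No notations: they clash with those of mathcomp-analysis. *)
From mathcomp Require Import (canonicals, coercions) mpoly.

Set Implicit Arguments.
Unset Strict Implicit.
Unset Printing Implicit Defensive.

Import Order.TTheory GRing.Theory Num.Theory.
Import numFieldNormedType.Exports.

Local Open Scope classical_set_scope.
Local Open Scope ring_scope.

Section Calculus.
Variables (R : realType) (n : nat).
Implicit Types (u : 'rV[R]_n -> R) (x : 'rV[R]_n).

Definition partial (i : 'I_n) u : 'rV[R]_n -> R := fun x => 'D_(delta_mx 0 i) u x.

Definition gradient u x : 'rV[R]_n := \row_i partial i u x.

Definition hessian u x : 'M[R]_n := \matrix_(i, j) partial i (partial j u) x.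

(* [derive] is total, so the existence of the partial derivatives is asserted
   separately. *)
Fixpoint is_Ck (k : nat) u : Prop :=
  continuous u /\
  if k is k'.+1 then
    forall i : 'I_n,
      (forall x, derivable u x (delta_mx 0 i)) /\ is_Ck k' (partial i u)
  else True.

Definition smooth u : Prop := forall k, is_Ck k u.

End Calculus.

Section SymmetricFunctions.
Variables (R : realType) (n : nat).
Implicit Types B : 'M[R]_n.

(* Eigenvalues with algebraic multiplicity, in an unspecified order. They exist
   when B is symmetric; 0 is a junk value for the matrices whose characteristic
   polynomial does not split over R. *)
Definition eigenvalues B : 'rV[R]_n :=
  xget 0 [set lam : 'rV[R]_n |
           char_poly B = \prod_(i < n) ('X - (lam 0 i)%:P)].

(* The sets h of cardinality l encode the l-tuples i_1 < ... < i_l;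
   for l = 0 this is 1. *)
Definition sigma (l : nat) B : R :=
  \sum_(h : {set 'I_n} | #|h| == l) \prod_(i in h) eigenvalues B 0 i.

Definition q (n1 n2 : nat) B : R := sigma n1 B / sigma n2 B.

(* Symmetry is not required: the only matrices considered are Hessians of
   smooth functions, which are symmetric. *)
Definition positive_definite B : Prop :=
  forall v : 'rV[R]_n, v != 0 -> 0 < (v *m B *m v^T) 0 0.

End SymmetricFunctions.

Definition strictly_convex (R : realType) (n : nat) (u : 'rV[R]_n -> R) : Prop :=
  forall x, positive_definite (hessian u x).

(* [msize p] is the total degree of p plus one (and 0 for p = 0). *)
Definition quadratic (R : realType) (n : nat) (u : 'rV[R]_n -> R) : Prop :=
  exists p : mpoly.mpoly n R,
    (mpoly.msize p <= 3)%N /\ forall x, u x = mpoly.meval (x 0) p.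

(* Main.v *)
(* The phase phi = x.Du/2 - u = ln q(D^2 u) satisfies F(D^2 phi) = x.Dphi/2, where F = dE at D^2 u
   and E = ln q. The operator F is elliptic, and F(D^2 u) = m := n1 - n2 by homogeneity.

   First, u is coercive: otherwise -u_e > 0 for some direction e, and at a minimum of
   -u_e + eps (u - u(0) - x.Du(0)) the equation F(D^2 u_e) = phi_e bounds -u_e by 2 eps m on a
   fixed compact set.

   Next, phi attains its maximum. Compare phi with the barrier -4m ln(T - u), which blows up on
   {u = T}; that is, maximise exp(phi / 4m) (T - u) over {u <= T}. At a maximum D phi = p Du, so
   D^2u x = (1 + 2p) Du, and the Cauchy-Schwarz inequality for D^2u gives
   F(Du, Du) <= m x.Du / (1 + 2p). The second order condition then forces x.Du <= 4m, hence
   u <= u(0) + 4m by convexity. Letting T tend to infinity, sup phi is reached on that compact set.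

   By the strong maximum principle phi is constant. Then D^2 u is constant along rays, hence
   constant, and u = x.Du/2 - phi is quadratic. *)
Require Import Defs.
From HB Require Import structures.
From mathcomp Require Import all_boot all_order all_algebra.
From mathcomp Require Import all_fingroup.
From mathcomp Require Import all_classical all_reals all_analysis.
From mathcomp Require Import ring lra.
From mathcomp Require Import (canonicals, coercions) mpoly.

Import Order.TTheory GRing.Theory Num.Theory.
Import numFieldNormedType.Exports.

Local Open Scope classical_set_scope.
Local Open Scope ring_scope.

(** * Elementary symmetric functions *)

(** No bound on D^2 u is known and F is not uniformly elliptic on the whole space. The global
    estimates therefore use only two facts about F: it is monotone for the semidefinite order, and
    F(D^2 u) = m. This is why every comparison is made with a multiple of D^2 u: through eps u in
    the proof of coercivity, through T - u in the barrier, and through Cauchy-Schwarz for a rank one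
    matrix. Ellipticity constants enter only on a compact set, in the strong maximum principle.

    Differentiating the equation gives F(D^3 u[v]) = v.Dphi for every v. In D^2 phi the terms D^2 u
    cancel and leave D^3 u[x] / 2, so v = x yields the equation for phi, while a fixed v = e yields
    the one for u_e.

    Eigenvalues need not be smooth where they cross, so F is not obtained from them: sigma_l is the
    coefficient of X^l in det(1 + X B), to which Jacobi's formula applies. Ellipticity then reduces
    to the log-concavity of elementary symmetric functions of positive numbers. *)

Definition elsym {R : comNzRingType} (s : seq R) (l : nat) : R :=
  (\prod_(a <- s) (1 + a *: 'X))`_l.

(** Index l - 1, with the value 0 at index -1. The truncated predecessor would give 1 there, whereas
    the derivative of sigma_0 has to vanish when n2 = 0. *)
Definition elsym_shift {R : comNzRingType} (s : seq R) (l : nat) : R :=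
  if l is l'.+1 then elsym s l' else 0.

Lemma elsym_cons {R : comNzRingType} (a : R) s l :
  elsym (a :: s) l = elsym s l + a * elsym_shift s l.
Proof.
rewrite /elsym big_cons mulrDl mul1r coefD -scalerAl coefZ coefXM.
by case: l.
Qed.

Lemma elsym_nil {R : comNzRingType} l : @elsym R [::] l = (l == 0%N)%:R.
Proof. by rewrite /elsym big_nil coef1. Qed.

Lemma elsym_gt_size {R : comNzRingType} (s : seq R) l :
  (size s < l)%N -> elsym s l = 0.
Proof.
elim: s l => [|a s IH] [|l] //= sl; first by rewrite elsym_nil.
by rewrite elsym_cons /= !IH ?mulr0 ?addr0 // ltnW.
Qed.

Lemma elsym_gt0 {R : realDomainType} (s : seq R) l :
  {in s, forall a, 0 < a} -> (l <= size s)%N -> 0 < elsym s l.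
Proof.
elim: s l => [|a s IH] l pos ls.
  by move: ls; rewrite leqn0 => /eqP->; rewrite elsym_nil eqxx.
have pa : 0 < a by apply: pos; rewrite mem_head.
have ps : {in s, forall b, 0 < b} by move=> b bs; apply: pos; rewrite in_cons bs orbT.
rewrite elsym_cons; case: l ls => [|l] ls /=.
  by rewrite mulr0 addr0 IH.
have [->|ls'] := eqVneq l (size s); last first.
  by rewrite addr_gt0 ?mulr_gt0 ?IH // ltn_neqAle ls' -ltnS.
by rewrite (@elsym_gt_size _ s (size s).+1) // add0r mulr_gt0 // IH.
Qed.

Lemma elsym_ge0 {R : realDomainType} (s : seq R) l :
  {in s, forall a, 0 < a} -> 0 <= elsym s l.
Proof.
move=> pos; have [ls|ls] := leqP l (size s); first by rewrite ltW // elsym_gt0.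
by rewrite elsym_gt_size.
Qed.

(* A 2x2 minor of the Toeplitz matrix of elementary symmetric functions. *)
Definition elsym_minor {R : comNzRingType} (s : seq R) a b : R :=
  elsym s a * elsym s b - elsym s a.+1 * elsym_shift s b.

Lemma elsym_minor_diag {R : comNzRingType} (s : seq R) a :
  elsym_minor s a a.+1 = 0.
Proof. by rewrite /elsym_minor /= mulrC subrr. Qed.

Lemma elsym_minor_cons {R : comNzRingType} x (s : seq R) a b :
  elsym_minor (x :: s) a.+1 b.+1 =
    elsym_minor s a.+1 b.+1 + x * (elsym_minor s a.+1 b + elsym_minor s a b.+1)
    + x ^+ 2 * elsym_minor s a b.
Proof. by rewrite /elsym_minor /= !elsym_cons /=; ring. Qed.

(** The range b <= a + 1 is stable under [elsym_minor_cons]: the term with indices a and b + 1 may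
    reach b = a + 1, where the two rows of the minor coincide. *)
Lemma elsym_minor_ge0 {R : realDomainType} (s : seq R) a b :
  {in s, forall a, 0 < a} -> (b <= a.+1)%N -> 0 <= elsym_minor s a b.
Proof.
elim: s a b => [|x s IH] a b pos.
  rewrite leq_eqVlt => /orP[/eqP->|ba]; first by rewrite elsym_minor_diag.
  by rewrite /elsym_minor !elsym_nil /= mul0r subr0 mulr_ge0 // ler0n.
have px : 0 < x by apply: pos; rewrite mem_head.
have {}IH a' b' : (b' <= a'.+1)%N -> 0 <= elsym_minor s a' b'.
  by apply: IH => c cs; apply: pos; rewrite in_cons cs orbT.
case: b => [|b] ba.
  by rewrite /elsym_minor /= mulr0 subr0 mulr_ge0 // elsym_ge0.
move: ba; rewrite leq_eqVlt => /orP[/eqP[->]|]; first by rewrite elsym_minor_diag.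
case: a => [//|a] ba.
rewrite elsym_minor_cons.
have h1 := IH a.+1 b.+1 (ltnW ba).
have h2 := IH a.+1 b (ltnW (ltnW ba)).
have h3 := IH a b.+1 ba.
have h4 := IH a b (ltnW ba).
apply: addr_ge0; first apply: addr_ge0 => //.
  by apply: mulr_ge0; [exact: ltW | exact: addr_ge0].
by apply: mulr_ge0 => //; rewrite exprn_ge0 // ltW.
Qed.

(** Strictness is carried by the term free of x, the minor of the shorter list, until a reaches the
    full length; there [elsym s a.+1] vanishes and a product of two positive numbers remains. *)
Lemma elsym_minor_gt0 {R : realDomainType} (s : seq R) a b :
    {in s, forall a, 0 < a} -> (b <= a)%N -> (a <= size s)%N ->
  0 < elsym_minor s a b.
Proof.
elim: s a b => [|x s IH] a b pos ba sa.
  move: sa ba; rewrite leqn0 => /eqP->; rewrite leqn0 => /eqP->.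
  by rewrite /elsym_minor !elsym_nil /= mulr0 subr0 mulr1 ltr01.
have [ea|na] := eqVneq a (size s).+1.
  rewrite /elsym_minor [elsym _ a.+1]elsym_gt_size ?ea // mul0r subr0.
  by rewrite mulr_gt0 // elsym_gt0 //= -?ea.
have {na} sa' : (a <= size s)%N by rewrite -ltnS ltn_neqAle na.
case: b ba => [|b] ba.
  by rewrite /elsym_minor /= mulr0 subr0 mulr_gt0 // elsym_gt0.
case: a ba sa sa' => [//|a] ba sa sa'.
have px : 0 < x by apply: pos; rewrite mem_head.
have ps : {in s, forall b, 0 < b}.
  by move=> c cs; apply: pos; rewrite in_cons cs orbT.
have h2 : 0 <= elsym_minor s a.+1 b by rewrite elsym_minor_ge0 // ltnW // ltnW.
have h3 : 0 <= elsym_minor s a b.+1 by rewrite elsym_minor_ge0.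
have h4 : 0 <= elsym_minor s a b by rewrite elsym_minor_ge0 // ltnW.
rewrite elsym_minor_cons.
apply: ltr_wpDr; first by apply: mulr_ge0 => //; rewrite exprn_ge0 // ltW.
apply: ltr_wpDr; last exact: IH.
by apply: mulr_ge0; [exact: ltW | exact: addr_ge0].
Qed.

(** * Real functions and the dot product *)

Section ContinuousReal.
Context {R : realType} {T : topologicalType}.
Implicit Types f g : T -> R.

Lemma continuous_addr f g :
  continuous f -> continuous g -> continuous (fun x => f x + g x).
Proof. by move=> cf cg x; apply: cvgD; [exact: cf | exact: cg]. Qed.

Lemma continuous_oppr f : continuous f -> continuous (fun x => - f x).
Proof. by move=> cf x; apply: cvgN; exact: cf. Qed.

Lemma continuous_mulr f g :
  continuous f -> continuous g -> continuous (fun x => f x * g x).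
Proof. by move=> cf cg x; apply: cvgM; [exact: cf | exact: cg]. Qed.

Lemma continuous_invr f :
  (forall x, f x != 0) -> continuous f -> continuous (fun x => (f x)^-1).
Proof. by move=> f0 cf x; apply: cvgV; [exact: f0 | exact: cf]. Qed.

Lemma continuous_cstr (c : R) : continuous (fun _ : T => c).
Proof. by move=> x; exact: cvg_cst. Qed.

Lemma continuous_sumr (I : Type) (r : seq I) (P : pred I) (f : I -> T -> R) :
  (forall i, continuous (f i)) -> continuous (fun x => \sum_(i <- r | P i) f i x).
Proof.
move=> cf; apply: continuous_big => // x.
exact: (@add_continuous R).
Qed.

Lemma closed_le_fun f (c : R) : continuous f -> closed [set x | f x <= c].
Proof. by move=> /continuous_closedP /(_ _ (@closed_le R c)). Qed.

Lemma closed_ge_fun f (c : R) : continuous f -> closed [set x | c <= f x].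
Proof. by move=> /continuous_closedP /(_ _ (@closed_ge R c)). Qed.

Lemma closed_eq_fun f (c : R) : continuous f -> closed [set x | f x = c].
Proof. by move=> /continuous_closedP /(_ _ (@closed_eq R c)). Qed.

End ContinuousReal.

Section Dot.
Context {R : realType} {n : nat}.
Implicit Types x y z : 'rV[R]_n.

Definition dot x y : R := \sum_i x 0 i * y 0 i.

Lemma dotE x y : dot x y = (x *m y^T) 0 0.
Proof. by rewrite mxE; apply: eq_bigr => i _; rewrite mxE. Qed.

Lemma dotC x y : dot x y = dot y x.
Proof. by apply: eq_bigr => i _; rewrite mulrC. Qed.

Lemma dotDl x y z : dot (x + y) z = dot x z + dot y z.
Proof. by rewrite -big_split; apply: eq_bigr => i _; rewrite mxE mulrDl. Qed.

Lemma dotZl (a : R) x y : dot (a *: x) y = a * dot x y.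
Proof. by rewrite mulr_sumr; apply: eq_bigr => i _; rewrite mxE mulrA. Qed.

Lemma dotDr x y z : dot z (x + y) = dot z x + dot z y.
Proof. by rewrite dotC dotDl !(dotC z). Qed.

Lemma dotZr (a : R) x y : dot x (a *: y) = a * dot x y.
Proof. by rewrite dotC dotZl dotC. Qed.

Lemma dotNl x y : dot (- x) y = - dot x y.
Proof. by rewrite -scaleN1r dotZl mulN1r. Qed.

Lemma dotNr x y : dot x (- y) = - dot x y.
Proof. by rewrite dotC dotNl dotC. Qed.

Lemma dotBl x y z : dot (x - y) z = dot x z - dot y z.
Proof. by rewrite dotDl dotNl. Qed.

Lemma dotBr x y z : dot z (x - y) = dot z x - dot z y.
Proof. by rewrite dotDr dotNr. Qed.

Lemma dot0l x : dot 0 x = 0.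
Proof. by rewrite -(scale0r x) dotZl mul0r. Qed.

Lemma dot0r x : dot x 0 = 0.
Proof. by rewrite dotC dot0l. Qed.

Lemma dot_mul x y (M : 'M[R]_n) : dot (x *m M) y = dot x (y *m M^T).
Proof. by rewrite !dotE trmx_mul trmxK mulmxA. Qed.

Lemma dotxx_ge0 x : 0 <= dot x x.
Proof. by apply: sumr_ge0 => i _; rewrite -expr2 sqr_ge0. Qed.

Lemma dotxx_eq0 x : (dot x x == 0) = (x == 0).
Proof.
apply/idP/eqP => [|->]; last by rewrite dot0l.
rewrite psumr_eq0; last by move=> i _; rewrite -expr2 sqr_ge0.
move=> /allP h; apply/rowP => i; rewrite mxE.
by have := h i (mem_index_enum i); rewrite /= mulf_eq0 orbb => /eqP.
Qed.

Lemma dotxx_gt0 x : x != 0 -> 0 < dot x x.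
Proof. by move=> x0; rewrite lt_def dotxx_ge0 dotxx_eq0 x0. Qed.

Lemma sqr_coord_le x i : x 0 i ^+ 2 <= dot x x.
Proof.
rewrite /dot (bigD1 i) //= -expr2 lerDl; apply: sumr_ge0 => j _.
by rewrite -expr2 sqr_ge0.
Qed.

Lemma dot_deltar x i : dot x (delta_mx 0 i) = x 0 i.
Proof.
rewrite /dot (bigD1 i) //= mxE !eqxx mulr1 big1 ?addr0 // => j ji.
by rewrite mxE eqxx /= (negbTE ji) mulr0.
Qed.

Lemma continuous_dot {T : topologicalType} (f g : T -> 'rV[R]_n) :
    (forall i, continuous (fun t => f t 0 i)) ->
    (forall i, continuous (fun t => g t 0 i)) ->
  continuous (fun t => dot (f t) (g t)).
Proof.
move=> cf cg; apply: continuous_sumr => i.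
by apply: continuous_mulr; [exact: cf | exact: cg].
Qed.

Lemma coord_continuous_row (i : 'I_n) : continuous (fun x : 'rV[R]_n => x 0 i).
Proof. exact: coord_continuous. Qed.

Lemma compact_dot_bounded (A : set 'rV[R]_n) (C : R) :
  (forall x, A x -> dot x x <= C) -> closed A -> compact A.
Proof.
move=> AC; apply: bounded_closed_compact.
exists (`|C| + 1); split; first by rewrite num_real.
move=> M CM x /AC xC /=.
have M0 : 0 <= M by rewrite (le_trans _ (ltW CM)) // addr_ge0.
rewrite [leLHS]/Num.Def.normr /= mx_normrE; apply/bigmax_leP; split => // -[i j] _ /=.
rewrite ord1 -(@ler_pXn2r _ 2) ?nnegrE // real_normK ?num_real //.
apply: (le_trans (sqr_coord_le x j)); apply: (le_trans xC).
apply: (le_trans (ler_norm C)).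
have C1 : `|C| <= M by rewrite (le_trans _ (ltW CM)) // lerDl.
have M1 : 1 <= M by rewrite (le_trans _ (ltW CM)) // lerDr.
by rewrite (le_trans C1) // expr2 ler_peMr.
Qed.

End Dot.

(** * Positive semidefinite forms *)

Section PositiveSemidefinite.
Context {R : realType} {n : nat}.
Implicit Types (M : 'M[R]_n) (v w : 'rV[R]_n).

Definition psd M := forall v, 0 <= dot (v *m M) v.

Lemma psd_cauchy_schwarz M v w : M^T = M -> psd M ->
  dot (v *m M) w ^+ 2 <= dot (v *m M) v * dot (w *m M) w.
Proof.
move=> Msym Mpsd.
set a := dot (v *m M) v; set b := dot (v *m M) w; set c := dot (w *m M) w.
have P t : 0 <= a + 2 * t * b + t ^+ 2 * c.
  have := Mpsd (v + t *: w).
  rewrite mulmxDl -scalemxAl dotDl !dotDr !dotZl !dotZr -/a -/b -/c.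
  by rewrite [dot (w *m M) v]dot_mul Msym [dot w _]dotC -/b; congr (_ <= _); ring.
have c0 : 0 <= c := Mpsd w.
have [c_eq0|c_neq0] := eqVneq c 0.
  suff -> : b = 0 by rewrite expr0n /= c_eq0 mulr0.
  apply/eqP/negP => /negP b0.
  (* For c = 0 the polynomial is affine in t, and this t gives it the value -1. *)
  have := P (- (a + 1) / (2 * b)); rewrite c_eq0 mulr0 addr0.
  have -> : a + 2 * (- (a + 1) / (2 * b)) * b = -1 by field; rewrite b0.
  by rewrite oppr_ge0 ler10.
have cgt0 : 0 < c by rewrite lt_def c_neq0.
have := P (- b / c).
have -> : a + 2 * (- b / c) * b + (- b / c) ^+ 2 * c = (a * c - b ^+ 2) / c.
  by field.
by rewrite pmulr_lge0 ?invr_gt0 // subr_ge0.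
Qed.

(** Cauchy-Schwarz against w = v M bounds the fourth power of the norm of v M by 0. *)
Lemma psd_dot_eq0 M v : M^T = M -> psd M -> dot (v *m M) v = 0 -> v *m M = 0.
Proof.
move=> Msym Mpsd v0; apply/eqP; rewrite -dotxx_eq0; apply/eqP.
have := @psd_cauchy_schwarz M v (v *m M) Msym Mpsd; rewrite v0 mul0r => h.
by apply/eqP; rewrite -sqrf_eq0; apply/eqP/le_anti; rewrite h sqr_ge0.
Qed.

End PositiveSemidefinite.

(** * Diagonalization of real symmetric matrices *)

Section Spectral.
Context {R : realType}.

(* A maximiser [v] of [v B v^T] on the unit sphere is a null vector of the positive
   semidefinite matrix [mu - B]. *)
Lemma symmetric_eigenvector n (B : 'M[R]_n.+1) : B^T = B ->
  exists v mu, dot v v = 1 /\ v *m B = mu *: v.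
Proof.
move=> Bsym.
pose A := [set v : 'rV[R]_n.+1 | dot v v = 1].
have cdot : continuous (fun v : 'rV[R]_n.+1 => dot v v).
  by apply: continuous_dot => i; exact: coord_continuous_row.
have A0 : A !=set0.
  by exists (delta_mx 0 0); rewrite /A /= dot_deltar mxE !eqxx.
have cA : compact A.
  apply: (@compact_dot_bounded _ _ _ 1) => [x -> //|].
  exact: closed_eq_fun.
have cf : continuous (fun v : 'rV[R]_n.+1 => dot (v *m B) v).
  apply: continuous_dot => i; last exact: coord_continuous_row.
  under eq_fun do rewrite mxE.
  apply: continuous_sumr => j; apply: continuous_mulr.
    exact: coord_continuous_row.
  exact: continuous_cstr.
have [v vA vmax] := EVT_max_rV A0 cA (continuous_subspaceT cf).
rewrite inE /A /= in vA; exists v, (dot (v *m B) v); split => //.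
set mu := dot (v *m B) v.
pose M := mu%:M - B.
have Msym : M^T = M by rewrite /M linearB /= tr_scalar_mx Bsym.
have MB w : dot (w *m M) w = mu * dot w w - dot (w *m B) w.
  by rewrite /M mulmxBr mul_mx_scalar dotBl dotZl.
have Mpsd : psd M.
  move=> w; rewrite MB subr_ge0.
  have [->|w0] := eqVneq w 0; first by rewrite mul0mx !dot0l mulr0.
  have s0 : 0 < dot w w by exact: dotxx_gt0.
  set r := Num.sqrt (dot w w).
  have r0 : 0 < r by rewrite sqrtr_gt0.
  have r2 : r ^+ 2 = dot w w by rewrite sqr_sqrtr // ltW.
  have wA : (r^-1 *: w) \in A.
    by rewrite inE /A /= dotZl dotZr -r2; field; rewrite gt_eqF.
  have := vmax _ wA; rewrite -/mu -scalemxAl dotZl dotZr -r2 mulrA => h.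
  have -> : dot (w *m B) w = r ^+ 2 * (r^-1 * r^-1 * dot (w *m B) w).
    by field; rewrite gt_eqF.
  by rewrite [mu * _]mulrC ler_wpM2l ?sqr_ge0.
have : v *m M = 0 by apply: psd_dot_eq0 => //; rewrite MB vA mulr1 subrr.
by rewrite /M mulmxBr mul_mx_scalar => /eqP; rewrite subr_eq0 => /eqP.
Qed.

(** H is the reflection in the hyperplane orthogonal to w = v - e, which exchanges the unit vectors
    e and v; equality of their lengths gives s = -2 e.w. For v = e there is no such hyperplane. *)
Lemma householder n (v : 'rV[R]_n.+1) : dot v v = 1 ->
  exists H : 'M[R]_n.+1, [/\ H^T = H, H *m H = 1%:M & delta_mx 0 0 *m H = v].
Proof.
move=> v1; set e : 'rV[R]_n.+1 := delta_mx 0 0.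
have [<-|ve] := eqVneq e v.
  by exists 1%:M; split; rewrite ?trmx1 ?mulmx1.
have [w wE] : exists w, w = v - e by exists (v - e).
pose s := dot w w.
have e1 : dot e e = 1 by rewrite dot_deltar mxE !eqxx.
have s0 : s != 0 by rewrite dotxx_eq0 wE subr_eq0 eq_sym.
have sE : s = - 2 * dot e w.
  by rewrite /s wE !dotBl !dotBr e1 v1 (dotC v e); ring.
have wwT : w *m w^T = s%:M by rewrite [LHS]mx11_scalar -dotE.
pose H := 1%:M - (2 / s) *: (w^T *m w).
exists H; split.
- by rewrite /H linearB /= trmx1 linearZ /= trmx_mul trmxK.
- rewrite /H mulmxBl mul1mx mulmxBr -scalemxAl -scalemxAr mulmx1.
  rewrite -scalemxAl mulmxA -(mulmxA w^T w) wwT mul_mx_scalar -scalemxAl !scalerA.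
  rewrite -scalerBl -addrA -opprD -scalerDl.
  set k := (X in X *: _).
  have -> : k = 0 by rewrite /k; field.
  by rewrite scale0r subr0.
- rewrite /H mulmxBr mulmx1 -scalemxAr mulmxA.
  have -> : e *m w^T = (- s / 2)%:M.
    by rewrite [LHS]mx11_scalar -dotE sE; congr (_%:M); field.
  rewrite mul_scalar_mx scalerA.
  have -> : 2 / s * (- s / 2) = -1 by field.
  by rewrite scaleN1r opprK wE addrC subrK.
Qed.

(** A reflection makes the first basis vector an eigenvector; symmetry clears the first column along
    with the first row, and induction treats the remaining block. *)
Lemma symmetric_diagonalizable n (B : 'M[R]_n) : B^T = B ->
  exists (P : 'M[R]_n) (d : 'rV[R]_n), P *m P^T = 1%:M /\ P *m B *m P^T = diag_mx d.
Proof.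
elim: n B => [|n IH] B Bsym.
  by exists 1%:M, 0; split; apply/matrixP => -[].
have [v [mu [v1 vB]]] := symmetric_eigenvector _ _ Bsym.
have [H [Hsym HH eH]] := householder _ _ v1.
have [C Cdef] : exists C, C = H *m B *m H by eexists.
have Csym : C^T = C by rewrite Cdef !trmx_mul Hsym Bsym mulmxA.
have C0 : delta_mx 0 0 *m C = mu *: (delta_mx 0 0 : 'rV_n.+1).
  rewrite Cdef !mulmxA eH vB -scalemxAl; congr (_ *: _).
  by rewrite -eH -mulmxA HH mulmx1.
have C0j j : C 0 j = mu *+ (j == 0).
  have := congr1 (fun M : 'rV_n.+1 => M 0 j) C0.
  by rewrite -rowE !mxE eqxx /= mulr_natr eq_sym.
pose C1 : 'M[R]_(1 + n) := C.
have CE : C1 = block_mx mu%:M 0 0 (drsubmx C1).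
  rewrite -[LHS]submxK; congr block_mx.
  - apply/matrixP => i j; rewrite !ord1 !mxE /C1.
    have -> : lshift n (0 : 'I_1) = (0 : 'I_(n.+1)) by apply/val_inj.
    by rewrite C0j eqxx.
  - apply/matrixP => i j; rewrite !ord1 !mxE /C1.
    have -> : lshift n (0 : 'I_1) = (0 : 'I_(n.+1)) by apply/val_inj.
    by rewrite C0j.
  - apply/matrixP => i j; rewrite !ord1 !mxE /C1.
    have -> : lshift n (0 : 'I_1) = (0 : 'I_(n.+1)) by apply/val_inj.
    by rewrite -Csym mxE C0j.
have [|P [d [PP PD]]] := IH (drsubmx C1).
  by rewrite trmx_drsub /C1 Csym.
pose P1 : 'M[R]_(1 + n) := block_mx 1%:M 0 0 P.
have P1T : P1^T = block_mx 1%:M 0 0 P^T.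
  by rewrite /P1 tr_block_mx trmx1 !trmx0.
have PP1 : P1 *m P1^T = 1%:M.
  rewrite P1T /P1 mulmx_block !mul0mx !mulmx0 !addr0 !add0r mulmx1 PP.
  by rewrite -scalar_mx_block.
have PD1 : P1 *m C1 *m P1^T = diag_mx (row_mx mu%:M d).
  rewrite CE P1T /P1 !mulmx_block.
  rewrite !(mul0mx, mulmx0, addr0, add0r, mulmx1, mul1mx) PD.
  rewrite diag_mx_row; congr block_mx.
  by apply/matrixP => i j; rewrite !ord1 !mxE.
exists (mulmx (P1 : 'M[R]_n.+1) H), (row_mx mu%:M d : 'rV[R]_(1 + n)); split.
  rewrite trmx_mul Hsym mulmxA -(mulmxA (P1 : 'M[R]_n.+1)) HH mulmx1.
  exact: PP1.
rewrite trmx_mul Hsym.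
transitivity (P1 *m C1 *m P1^T); first by rewrite /C1 Cdef !mulmxA.
exact: PD1.
Qed.

End Spectral.

(** * Derivatives of determinants *)

Section DeriveReal.
Context {R : realType} {V : normedModType R}.
Implicit Types (f g : V -> R) (x v : V).

Lemma is_derive_addr f g x v a b : is_derive x v f a -> is_derive x v g b ->
  is_derive x v (fun y => f y + g y) (a + b).
Proof. by move=> df dg; exact: is_deriveD. Qed.

Lemma is_derive_subr f g x v a b : is_derive x v f a -> is_derive x v g b ->
  is_derive x v (fun y => f y - g y) (a - b).
Proof. by move=> df dg; exact: is_deriveB. Qed.

Lemma is_derive_mulr f g x v a b : is_derive x v f a -> is_derive x v g b ->
  is_derive x v (fun y => f y * g y) (f x * b + g x * a).
Proof. by move=> df dg; exact: is_deriveM. Qed.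

Lemma is_derive_cstr (c : R) x v : is_derive x v (fun _ : V => c) 0.
Proof. exact: is_derive_cst. Qed.

Lemma is_derive_sumr I (r : seq I) (P : pred I) (f : I -> V -> R) x v a :
    (forall i, is_derive x v (f i) (a i)) ->
  is_derive x v (fun y => \sum_(i <- r | P i) f i y) (\sum_(i <- r | P i) a i).
Proof.
move=> df; elim: r => [|i r IH].
  rewrite big_nil; under eq_fun do rewrite big_nil.
  exact: is_derive_cstr.
rewrite big_cons; under eq_fun do rewrite big_cons.
by case: (P i) => //; exact: is_derive_addr.
Qed.

Lemma is_derive_scaler (c : R) f x v a : is_derive x v f a ->
  is_derive x v (fun y => c * f y) (c * a).
Proof. by move=> df; exact: is_deriveZ. Qed.

Lemma is_derive_unique f x v a b :
  is_derive x v f a -> is_derive x v f b -> a = b.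
Proof. by move=> fa fb; rewrite -(@derive_val _ _ _ _ _ _ _ fa) derive_val. Qed.

(** Coefficientwise differentiation spares a topology on polynomials and keeps the indeterminate
    formal. *)
Definition poly_derive x v (p : V -> {poly R}) (dp : {poly R}) :=
  forall k, is_derive x v (fun y => (p y)`_k) dp`_k.

Lemma poly_derive_cst x v p : poly_derive x v (fun=> p) 0.
Proof. by move=> k; rewrite coef0; exact: is_derive_cstr. Qed.

Lemma poly_derive_mul x v p q dp dq :
    poly_derive x v p dp -> poly_derive x v q dq ->
  poly_derive x v (fun y => p y * q y) (p x * dq + q x * dp).
Proof.
move=> hp hq k.
under eq_fun do rewrite coefM.
apply: is_derive_eq.
  by apply: is_derive_sumr => i; apply: is_derive_mulr; [exact: hp | exact: hq].
by rewrite coefD [q x * dp]mulrC !coefM -big_split; apply: eq_bigr => i _ /=; ring.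
Qed.

Lemma poly_derive_sum x v I (r : seq I) (P : pred I) (p : I -> V -> {poly R}) dp :
    (forall i, poly_derive x v (p i) (dp i)) ->
  poly_derive x v (fun y => \sum_(i <- r | P i) p i y) (\sum_(i <- r | P i) dp i).
Proof.
move=> hp k; under eq_fun do rewrite coef_sum.
by rewrite coef_sum; apply: is_derive_sumr => i; exact: hp.
Qed.

Lemma poly_derive_prod x v (I : eqType) (r : seq I) (p : I -> V -> {poly R}) dp :
    uniq r -> (forall i, poly_derive x v (p i) (dp i)) ->
  poly_derive x v (fun y => \prod_(i <- r) p i y)
    (\sum_(i <- r) \prod_(j <- r) (if j == i then dp j else p j x)).
Proof.
move=> + hp; elim: r => [_|i r IH /= /andP[ir ur]].
  under eq_fun do rewrite big_nil.
  by rewrite big_nil; exact: poly_derive_cst.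
under eq_fun do rewrite big_cons.
move=> k; apply: is_derive_eq; first exact: (poly_derive_mul _ _ _ _ _ _ (hp i) (IH ur)).
congr ((polyseq _)`_k); rewrite big_cons big_cons eqxx addrC; congr (_ + _).
  rewrite mulrC; congr (_ * _); apply: eq_big_seq => j jr.
  by have [ji|//] := eqVneq j i; rewrite -ji jr in ir.
rewrite mulr_sumr; apply: eq_big_seq => j jr.
rewrite big_cons; have [ij|//] := eqVneq i j.
by rewrite ij jr in ir.
Qed.

(** Jacobi's formula. The Leibniz sum differentiates into determinants with one row replaced by its
    derivative; expansion along that row brings out cofactors of the original matrix. *)
Lemma poly_derive_det x v n (A : V -> 'M[{poly R}]_n) (dA : 'M[{poly R}]_n) :
    (forall i j, poly_derive x v (fun y => A y i j) (dA i j)) ->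
  poly_derive x v (fun y => \det (A y)) (\sum_i \sum_j dA i j * cofactor (A x) i j).
Proof.
move=> hA k; apply: is_derive_eq.
  apply: (poly_derive_sum x v _ _ _
    (fun (s : {perm 'I_n}) y => (-1) ^+ s * \prod_i A y i (s i)) _ _ k) => s.
  apply: poly_derive_mul; first exact: poly_derive_cst.
  apply: (poly_derive_prod x v _ _ (fun i y => A y i (s i)) (fun i => dA i (s i))).
    exact: index_enum_uniq.
  by move=> i; exact: hA.
congr ((polyseq _)`_k).
transitivity (\sum_i \det (\matrix_(k, j) if k == i then dA k j else A x k j)).
  rewrite exchange_big /=; apply: eq_bigr => s _.
  rewrite mulr0 addr0 mulr_sumr; apply: eq_bigr => i _; congr (_ * _).
  by apply: eq_bigr => j _; rewrite mxE.
apply: eq_bigr => i _; rewrite (expand_det_row _ i); apply: eq_bigr => j _.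
rewrite mxE eqxx; congr (_ * (_ * \det _)).
by apply/matrixP => a b; rewrite !mxE eq_sym (negbTE (neq_lift _ _)).
Qed.

End DeriveReal.

Lemma is_derive_affine {R : realType} (a b t : R) :
  is_derive t 1 (fun s => a + s * b) b.
Proof.
have h : is_derive t 1 (fun s : R => b * s) (b * 1).
  exact: (is_derive_scaler b (fun s : R => s)).
have -> : (fun s : R => a + s * b) = (fun s => a + b * s).
  by apply/funext => s; rewrite mulrC.
rewrite -[X in is_derive _ _ _ X]mulr1 -[X in is_derive _ _ _ X]add0r.
exact: is_derive_addr.
Qed.

(** * The functions sigma of symmetric matrices *)

Section Pencil.
Context {R : realType} {n : nat}.
Implicit Types (B P M : 'M[R]_n) (d : 'rV[R]_n).

(* For diagonal [B] the coefficients of [\det (1 + X B)] are the elementary symmetric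
   functions of the eigenvalues, so they express [sigma] as a polynomial in the entries. *)
Definition pencil B : 'M[{poly R}]_n := 1%:M + 'X *: map_mx polyC B.

Definition elsym_gen d : {poly R} := \prod_i (1 + d 0 i *: 'X).

Lemma elsym_genE d : elsym_gen d = \prod_(a <- [seq d 0 i | i <- enum 'I_n]) (1 + a *: 'X).
Proof. by rewrite big_map big_enum. Qed.

Lemma pencil_conj P B : P *m P^T = 1%:M ->
  map_mx polyC P *m pencil B *m map_mx polyC P^T = pencil (P *m B *m P^T).
Proof.
move=> PP; rewrite /pencil mulmxDr mulmx1 mulmxDl -map_mxM PP map_mx1.
by rewrite -scalemxAr -scalemxAl -!map_mxM.
Qed.

Lemma det_pencil_conj P B : P *m P^T = 1%:M ->
  \det (pencil (P *m B *m P^T)) = \det (pencil B).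
Proof.
move=> PP; rewrite -pencil_conj // !det_mulmx mulrAC -det_mulmx.
by rewrite -map_mxM PP map_mx1 det1 mul1r.
Qed.

Lemma pencil_diag d : pencil (diag_mx d) = diag_mx (\row_i (1 + d 0 i *: 'X)).
Proof.
apply/matrixP => i j; rewrite !mxE; case: eqVneq => [->|_].
  by rewrite !mulr1n -mul_polyC mulrC.
by rewrite !mulr0n polyC0 mulr0 addr0.
Qed.

Lemma det_pencil_diag d : \det (pencil (diag_mx d)) = elsym_gen d.
Proof. by rewrite pencil_diag det_diag; apply: eq_bigr => i _; rewrite mxE. Qed.

Lemma char_poly_conj P B : P *m P^T = 1%:M ->
  char_poly (P *m B *m P^T) = char_poly B.
Proof.
move=> PP; rewrite /char_poly.
have -> : char_poly_mx (P *m B *m P^T) =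
    map_mx polyC P *m char_poly_mx B *m map_mx polyC P^T.
  rewrite /char_poly_mx mulmxBr mulmxBl mul_mx_scalar -scalemxAl -!map_mxM PP.
  by rewrite map_mx1 scalemx1.
rewrite !det_mulmx mulrAC -det_mulmx.
by rewrite -map_mxM PP map_mx1 det1 mul1r.
Qed.

Lemma elsym_gen_coef d l :
  (elsym_gen d)`_l = \sum_(h : {set 'I_n} | #|h| == l) \prod_(i in h) d 0 i.
Proof.
rewrite /elsym_gen.
under eq_bigr do rewrite addrC.
rewrite bigA_distr /= coef_sum [RHS]big_mkcond /=; apply: eq_bigr => h _.
rewrite -big_mkcond /= scaler_prod prodr_const coefZ coefXn eq_sym.
by case: eqP => _; rewrite ?mulr1 ?mulr0.
Qed.

(** [eigenvalues] is a choice. Diagonalization shows that there is something to choose, and the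
    linear factors of the characteristic polynomial fix the tuple up to order, which the generating
    product does not see. *)
Lemma sigma_pencil B l : B^T = B -> sigma l B = (\det (pencil B))`_l.
Proof.
move=> Bsym; have [P [d [PP PD]]] := symmetric_diagonalizable _ _ Bsym.
rewrite -(det_pencil_conj P) // PD det_pencil_diag.
set e := eigenvalues B; have eB : char_poly B = \prod_(i < n) ('X - (e 0 i)%:P).
  apply: (@xgetPex _ 0 [set lam : 'rV[R]_n |
           char_poly B = \prod_(i < n) ('X - (lam 0 i)%:P)]%classic).
  exists d; rewrite /= -(char_poly_conj P) // PD char_poly_trig ?diag_mx_is_trig //.
  by apply: eq_bigr => i _; rewrite mxE eqxx.
rewrite /sigma -/e -elsym_gen_coef; congr ((polyseq _)`_l).
rewrite !elsym_genE; apply: perm_big; apply: prod_XsubC_eq.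
have big_coord (f : 'rV[R]_n) : \prod_(x <- [seq f 0 i | i <- enum 'I_n]) ('X - x%:P)
    = \prod_(i < n) ('X - (f 0 i)%:P) by rewrite big_map big_enum.
rewrite !big_coord -eB -(char_poly_conj P) // PD.
rewrite char_poly_trig ?diag_mx_is_trig //.
by apply: eq_bigr => i _; rewrite mxE eqxx.
Qed.


(** The differential of sigma_l at B along M, read off Jacobi's formula: the entries of the pencil
    have derivative X M_ij. *)
Definition dsigma l B M : R :=
  \sum_i \sum_j M i j * ('X * cofactor (pencil B) i j)`_l.

Lemma is_derive_det_pencil (V : normedModType R) (B : V -> 'M[R]_n) M x v l :
    (forall i j, is_derive x v (fun y => B y i j) (M i j)) ->
  is_derive x v (fun y => (\det (pencil (B y)))`_l) (dsigma l (B x) M).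
Proof.
move=> hB.
have hA i j : poly_derive x v (fun y => pencil (B y) i j) ('X * (M i j)%:P).
  move=> k; under eq_fun do rewrite !mxE coefD coefXM coefC.
  rewrite coefXM coefC; case: k => [|k] /=.
    by rewrite -[X in is_derive _ _ _ X]addr0; apply: is_derive_addr; exact: is_derive_cstr.
  rewrite -[X in is_derive _ _ _ X]add0r; apply: is_derive_addr.
  by case: k => [|k] /=; [exact: hB | exact: is_derive_cstr].
apply: is_derive_eq.
  exact: (poly_derive_det x v n (fun y => pencil (B y))
    (\matrix_(i, j) ('X * (M i j)%:P)) (fun i j => eq_ind_r _ (hA i j) (mxE _ _ _ _))).
rewrite coef_sum; apply: eq_bigr => i _; rewrite coef_sum; apply: eq_bigr => j _.
by rewrite mxE -mulrA mulrCA coefCM.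
Qed.

(** Differentiating the invariant determinant along B + t M, and using uniqueness of derivatives,
    avoids transforming the cofactors. *)
Lemma dsigma_conj P B M l : P *m P^T = 1%:M ->
  dsigma l (P *m B *m P^T) (P *m M *m P^T) = dsigma l B M.
Proof.
move=> PP.
pose C (A N : 'M[R]_n) (t : R) : 'M[R]_n := A + t *: N.
have dC A N : is_derive (0 : R) (1 : R)
    (fun t => (\det (pencil (C A N t)))`_l) (dsigma l A N).
  have -> : dsigma l A N = dsigma l (C A N 0) N by rewrite /C scale0r addr0.
  apply: is_derive_det_pencil => i j.
  under eq_fun do rewrite !mxE.
  exact: is_derive_affine.
apply: is_derive_unique; first exact: dC.
have -> : (fun t => (\det (pencil (C (P *m B *m P^T) (P *m M *m P^T) t)))`_l)
    = (fun t => (\det (pencil (C B M t)))`_l).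
  apply/funext => t; rewrite -(det_pencil_conj P (C B M t)) //.
  by rewrite /C mulmxDr mulmxDl -scalemxAr -scalemxAl.
exact: dC.
Qed.

(** The identity A adj(A) = det(A) is solved entrywise by cancelling diagonal entries. In the pencil
    these are 1 + d X, nonzero polynomials whatever d is. *)
Lemma cofactor_diag {S : idomainType} (a : 'rV[S]_n) i j :
    (forall k, a 0 k != 0) ->
  cofactor (diag_mx a) i j = (\prod_(k | k != i) a 0 k) *+ (i == j).
Proof.
move=> a0; have /matrixP/(_ j i) := mul_mx_adj (diag_mx a).
rewrite mul_diag_mx !mxE det_diag; case: (eqVneq j i) => [->|ji] h.
  apply: (mulfI (a0 i)); rewrite h !mulr1n.
  by rewrite (bigD1 i).
by apply: (mulfI (a0 j)); rewrite h mulr0.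
Qed.

(** The coefficient of X^l in X times this product is the partial derivative of sigma_l with respect
    to the i-th eigenvalue. *)
Definition elsym_gen_but d i : {poly R} := \prod_(k | k != i) (1 + d 0 k *: 'X).

Lemma elsym_gen_split d i :
  elsym_gen d = (1 + d 0 i *: 'X) * elsym_gen_but d i.
Proof. by rewrite /elsym_gen (bigD1 i). Qed.

Lemma dsigma_diag P B d M l : P *m P^T = 1%:M -> P *m B *m P^T = diag_mx d ->
  dsigma l B M = \sum_i (P *m M *m P^T) i i * ('X * elsym_gen_but d i)`_l.
Proof.
move=> PP PD; rewrite -(dsigma_conj P) // PD /dsigma; apply: eq_bigr => i _.
have cof j : cofactor (pencil (diag_mx d)) i j = elsym_gen_but d i *+ (i == j).
  rewrite pencil_diag cofactor_diag => [|k].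
    by congr (_ *+ _); apply: eq_bigr => k _; rewrite mxE.
  rewrite mxE; apply/negP => /eqP/(congr1 (fun p : {poly R} => p`_0)).
  by rewrite coefD coefZ coefX coef1 coef0 mulr0 addr0 => /eqP; rewrite oner_eq0.
rewrite (bigD1 i) //= cof eqxx mulr1n big1 ?addr0 // => j ji.
by rewrite cof eq_sym (negbTE ji) mulr0n mulr0 coef0 mulr0.
Qed.

(** Euler's identity in degree l: the operator X d/dX multiplies the coefficient of X^l by l. *)
Lemma elsym_gen_euler d l :
  \sum_i d 0 i * ('X * elsym_gen_but d i)`_l = l%:R * (elsym_gen d)`_l.
Proof.
have -> : \sum_i d 0 i * ('X * elsym_gen_but d i)`_l = ('X * (elsym_gen d)^`())`_l.
  rewrite /elsym_gen.
  have -> : (\prod_i (1 + d 0 i *: 'X))^`() = \sum_i d 0 i *: elsym_gen_but d i.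
    rewrite /elsym_gen_but.
    suff H (r : seq 'I_n) : uniq r -> (\prod_(i <- r) (1 + d 0 i *: 'X))^`() =
      \sum_(i <- r) d 0 i *: \prod_(k <- r | k != i) (1 + d 0 k *: 'X).
      by apply: H; exact: index_enum_uniq.
    elim: r => [_|i r IH /= /andP[ir ur]]; first by rewrite !big_nil derivC.
    rewrite !big_cons derivM IH // derivD derivC add0r derivZ derivX eqxx /=.
    congr (_ + _).
      rewrite -mul_polyC mulr1 mul_polyC; congr (_ *: _).
      rewrite [RHS]big_seq_cond [LHS]big_seq_cond; apply: eq_bigl => k.
      by case: (boolP (k \in r)) => //= kr; rewrite (memPn ir).
    rewrite mulr_sumr; apply: eq_big_seq => k kr.
    rewrite -scalerAr; congr (_ *: _); rewrite big_cons.
    by have [ik|//] := eqVneq i k; rewrite ik kr in ir.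
  by rewrite mulr_sumr coef_sum; apply: eq_bigr => i _; rewrite -scalerAr coefZ.
by rewrite coefXM coef_deriv; case: l => [|l] /=; rewrite ?mul0r // mulr_natl.
Qed.

End Pencil.

(** * The linearized operator *)

Section LinearizedOperator.
Context {R : realType} {n : nat}.
Variables n1 n2 : nat.
Implicit Types (B P M : 'M[R]_n) (d : 'rV[R]_n).

(* The matrix of partial derivatives of [ln (q n1 n2)] at [B]; the factor ['X]
   makes the derivative of [sigma 0] vanish. *)
Definition lin_coef B i j : R :=
  ('X * cofactor (pencil B) i j)`_n1 / (\det (pencil B))`_n1
  - ('X * cofactor (pencil B) i j)`_n2 / (\det (pencil B))`_n2.

Definition linop B M : R := \sum_i \sum_j M i j * lin_coef B i j.

Lemma linopE B M : linop B M =
  dsigma n1 B M / (\det (pencil B))`_n1 - dsigma n2 B M / (\det (pencil B))`_n2.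
Proof.
rewrite /dsigma !mulr_suml -sumrB; apply: eq_bigr => i _.
rewrite !mulr_suml -sumrB; apply: eq_bigr => j _.
by rewrite -!mulrA -mulrBr.
Qed.

Lemma linopD B M N : linop B (M + N) = linop B M + linop B N.
Proof.
rewrite -big_split; apply: eq_bigr => i _ /=; rewrite -big_split.
by apply: eq_bigr => j _; rewrite mxE mulrDl.
Qed.

Lemma linopZ B (a : R) M : linop B (a *: M) = a * linop B M.
Proof.
rewrite mulr_sumr; apply: eq_bigr => i _; rewrite mulr_sumr.
by apply: eq_bigr => j _; rewrite mxE mulrA.
Qed.

Lemma linopN B M : linop B (- M) = - linop B M.
Proof. by rewrite -scaleN1r linopZ mulN1r. Qed.

Hypothesis n21 : (n2 < n1)%N.
Hypothesis n1n : (n1 <= n)%N.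

(** In an orthonormal eigenbasis F is diagonal with weights g_i = e_{n1-1} / sigma_n1 - e_{n2-1} /
    sigma_n2, where e is taken over the eigenvalues other than the i-th. Positivity of the g_i is
    ellipticity, and Euler's identity gives n1 - n2. *)
Lemma linop_diag B : B^T = B -> positive_definite B ->
  [/\ 0 < (\det (pencil B))`_n1, 0 < (\det (pencil B))`_n2 &
    exists (P : 'M[R]_n) (g : 'I_n -> R), [/\ P *m P^T = 1%:M, forall i, 0 < g i,
      forall M, linop B M = \sum_i g i * (P *m M *m P^T) i i &
      linop B B = n1%:R - n2%:R]].
Proof.
move=> Bsym Bpos; have [P [d [PP PD]]] := symmetric_diagonalizable _ _ Bsym.
have PTP : P^T *m P = 1%:M by exact: mulmx1C.
have d0 i : 0 < d 0 i.
  have ri : row i P != 0.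
    apply/negP => /eqP ri; have /matrixP/(_ i i) := PP; rewrite !mxE eqxx.
    rewrite big1 => [/eqP|k _]; first by rewrite eq_sym oner_eq0.
    by have /rowP/(_ k) := ri; rewrite !mxE => ->; rewrite mul0r.
  have := Bpos _ ri; rewrite -row_mul -!dotE.
  have /matrixP/(_ i i) := PD; rewrite mxE [in RHS]mxE eqxx mulr1n => <-.
  by congr (0 < _); apply: eq_bigr => k _; rewrite !mxE.
have dP : {in [seq d 0 i | i <- enum 'I_n], forall a, 0 < a}.
  by move=> a /mapP[i _ ->].
have detE : \det (pencil B) = elsym_gen d.
  by rewrite -(det_pencil_conj P) // PD det_pencil_diag.
have spos l : (l <= n)%N -> 0 < (\det (pencil B))`_l.
  move=> ln; rewrite detE elsym_genE; apply: elsym_gt0 => //.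
  by rewrite size_map size_enum_ord.
have s1 := spos _ n1n; have s2 := spos _ (ltnW (leq_trans n21 n1n)).
split => //.
pose w i l : R := ('X * elsym_gen_but d i)`_l.
exists P, (fun i => w i n1 / (\det (pencil B))`_n1 - w i n2 / (\det (pencil B))`_n2).
split => //.
(* With sigma_l = e_l + d_i e_{l-1}, the terms containing d_i cancel; what remains is the minor with
   a = n1 - 1 and b = n2 of the other eigenvalues. *)
- move=> i; rewrite subr_gt0 ltr_pdivrMr // mulrAC ltr_pdivlMr //.
  rewrite detE (elsym_gen_split d i) !mulrDl !mul1r !coefD -scalerAl !coefZ.
  rewrite -/(w i n1) -/(w i n2) !mulrDr.
  rewrite [w i n2 * (d 0 i * _)]mulrC [w i n1 * (d 0 i * _)]mulrC.
  rewrite [_ * w i n1 * w i n2]mulrAC ltrD2r.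
  pose s := [seq d 0 k | k <- enum 'I_n & k != i].
  have esE : elsym_gen_but d i = \prod_(a <- s) (1 + a *: 'X).
    by rewrite /s big_map big_filter big_enum_cond.
  have wE l : w i l = elsym_shift s l.
    by rewrite /w coefXM esE; case: l.
  have ss : size s = n.-1.
    have := cardC1 i; rewrite card_ord => <-.
    by rewrite /s -sum1_size big_map big_filter big_enum_cond sum1_card.
  rewrite !wE; case: n1 n21 n1n => [//|a] ba an.
  rewrite /= esE -/(elsym s n2) -/(elsym s a.+1) -subr_gt0.
  rewrite [elsym_shift s n2 * _]mulrC.
  apply: elsym_minor_gt0 => //.
    by move=> b /mapP[k _ ->].
  by rewrite ss -ltnS prednK // (leq_trans _ an).
- move=> M; rewrite linopE !(dsigma_diag P B d) // !mulr_suml -sumrB.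
  by apply: eq_bigr => i _; rewrite -!mulrA -mulrBr mulrC.
- rewrite linopE !(dsigma_diag P B d) // PD.
  have dE l : \sum_i (diag_mx d) i i * ('X * elsym_gen_but d i)`_l =
      l%:R * (\det (pencil B))`_l.
    rewrite detE -elsym_gen_euler; apply: eq_bigr => i _.
    by rewrite mxE eqxx.
  by rewrite !dE !mulfK // gt_eqF.
Qed.

Section Properties.
Variable B : 'M[R]_n.
Hypotheses (Bsym : B^T = B) (Bpos : positive_definite B).

Lemma linop_self : linop B B = n1%:R - n2%:R.
Proof. by have [_ _ [P [g []]]] := linop_diag B Bsym Bpos. Qed.

Lemma linop_psd M : psd M -> 0 <= linop B M.
Proof.
move=> Mpsd; have [_ _ [P [g [_ g0 gE _]]]] := linop_diag B Bsym Bpos.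
rewrite gE.
apply: sumr_ge0 => i _. apply: mulr_ge0; first exact: ltW.
have := Mpsd (row i P); rewrite -row_mul => /le_trans; apply.
by rewrite mxE le_eqVlt; apply/orP; left; apply/eqP/eq_bigr => k _; rewrite !mxE.
Qed.

Lemma linop_le M N : psd (N - M) -> linop B M <= linop B N.
Proof. by move=> /linop_psd; rewrite linopD linopN subr_ge0. Qed.

(** Rotation to the eigenbasis keeps v nonzero, so some squared coordinate meets a positive weight.
    The barrier of the strong maximum principle needs this strict form. *)
Lemma linop_rank1_gt0 (v : 'rV[R]_n) : v != 0 -> 0 < linop B (v^T *m v).
Proof.
move=> v0; have [_ _ [P [g [PP g0 gE _]]]] := linop_diag B Bsym Bpos.
rewrite gE.
have PTP : P^T *m P = 1%:M by exact: mulmx1C.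
pose w := v *m P^T.
have wE i : (P *m (v^T *m v) *m P^T) i i = w 0 i ^+ 2.
  have -> : P *m (v^T *m v) *m P^T = w^T *m w.
    by rewrite /w trmx_mul trmxK !mulmxA.
  by rewrite mxE big_ord1 mxE expr2.
have w0 : w != 0.
  apply: contra v0 => /eqP w0.
  by rewrite -[v]mulmx1 -PTP mulmxA -/w w0 mul0mx.
have term_ge0 i : 0 <= g i * (P *m (v^T *m v) *m P^T) i i.
  by rewrite wE mulr_ge0 ?sqr_ge0 // ltW.
rewrite lt_def sumr_ge0 ?andbT => [|i _ //].
apply: contra w0 => /eqP s0; apply/eqP/rowP => i; rewrite [RHS]mxE.
have /eqP := psumr_eq0P (fun i _ => term_ge0 i) s0 (i := i) isT.
by rewrite wE mulf_eq0 gt_eqF // sqrf_eq0 => /eqP.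
Qed.

End Properties.

End LinearizedOperator.

(** * Differentiation along lines *)

Section OneVariable.
Context {R : realType}.
Implicit Types (f df : R -> R).

Lemma is_derive_continuous f df : (forall s : R, is_derive s 1 f (df s)) -> continuous f.
Proof.
by move=> hf s; apply/differentiable_continuous/derivable1_diffP; apply: ex_derive.
Qed.

Lemma MVT_between f df a b : (forall s : R, is_derive s 1 f (df s)) ->
  exists2 c, `|c - a| <= `|b - a| & f b - f a = df c * (b - a).
Proof.
move=> hf; have cf := is_derive_continuous _ _ hf.
have [ab|/ltW ba] := leP a b.
  have [c cab E] := MVT_segment ab (fun s _ => hf s) (continuous_subspaceT cf).
  exists c => //; move: cab; rewrite in_itv /= => /andP[ac cb].
  by rewrite !ger0_norm ?subr_ge0 // lerB.
have [c cab E] := MVT_segment ba (fun s _ => hf s) (continuous_subspaceT cf).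
exists c; last by rewrite -opprB E; ring.
move: cab; rewrite in_itv /= => /andP[bc ca].
by rewrite !ler0_norm ?subr_le0 // lerN2 lerB.
Qed.

(** Were d2 positive, its difference quotient would make df positive just to the right of 0, and f
    would increase there. *)
Lemma local_max_derivatives f df (d2 e : R) :
    (forall s : R, is_derive s 1 f (df s)) -> is_derive (0 : R) 1 df d2 -> 0 < e ->
    (forall s, `|s| < e -> f s <= f 0) ->
  df 0 = 0 /\ d2 <= 0.
Proof.
move=> hf hd2 e0 fmax.
have df0 : df 0 = 0.
  have h : is_derive (0 : R) 1 f 0.
    apply: (@derive1_at_max _ f (- e) e).
    - by rewrite ge0_cp // ltW.
    - by move=> t _; apply: ex_derive.
    - by rewrite in_itv /= oppr_lt0 e0.
    - by move=> t; rewrite in_itv /= => te; apply: fmax; rewrite ltr_norml.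
  exact: (is_derive_unique _ _ _ _ _ (hf 0) h).
split => //; rewrite leNgt; apply/negP => d2_gt0.
have [hder hval] := hd2.
have cv : (fun h => h^-1 *: (df (h *: 1 + 0) - df 0)) @ 0^' --> d2.
  by rewrite -hval; exact: hder.
have := cvgr_gt d2 cv _ d2_gt0.
rewrite near_withinE => /(_ _)/nbhs_ballP[r /= r0 hr].
pose s : R := Num.min r e / 2.
have m0 : 0 < Num.min r e by rewrite lt_min r0.
have s0 : 0 < s by rewrite divr_gt0.
have sm : s < Num.min r e by rewrite /s; lra.
have [sr se] : s < r /\ s < e by move: sm; rewrite lt_min => /andP.
have df_gt0 t : 0 < t -> t <= s -> 0 < df t.
  move=> t0 ts; have := hr t; rewrite /ball /= sub0r normrN gtr0_norm //.
  move=> /(_ (le_lt_trans ts sr)); rewrite gt_eqF // => /(_ isT).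
  by rewrite df0 subr0 addr0 [t *: 1]mulr1 pmulr_rgt0 // invr_gt0.
have cf := is_derive_continuous _ _ hf.
have [c] := MVT s0 (fun t _ => hf t) (continuous_subspaceT cf).
rewrite in_itv /= subr0 => /andP[c0 cs] E.
have : 0 < f s - f 0 by rewrite E mulr_gt0 // df_gt0 // ltW.
by rewrite subr_gt0 ltNge fmax // gtr0_norm.
Qed.

End OneVariable.

Section Lines.
Context {R : realType} {V : normedModType R}.
Implicit Types (f : V -> R) (x v w : V).

Lemma is_derive_line f x v s d : is_derive (x + s *: v) v f d ->
  is_derive s 1 (fun t => f (x + t *: v)) d.
Proof.
move=> [hder hval].
have E : (fun h : R => h^-1 *: (f (x + (h *: 1 + s) *: v) - f (x + s *: v)))
       = (fun h => h^-1 *: (f (h *: v + (x + s *: v)) - f (x + s *: v))).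
  by apply/funext => h; rewrite [h *: 1]mulr1 scalerDl addrCA.
apply: DeriveDef.
  by move: hder; rewrite /derivable /= -E.
by rewrite -hval /derive /= -E.
Qed.

Lemma is_derive_line0 f x v d :
  is_derive (0 : R) 1 (fun t => f (x + t *: v)) d -> is_derive x v f d.
Proof.
move=> [hder hval].
have E : (fun h : R => h^-1 *: (f (x + ((h *: 1 + 0 : R)) *: v) - f (x + (0 : R) *: v)))
       = (fun h => h^-1 *: (f (h *: v + x) - f x)).
  by apply/funext => h; rewrite [h *: 1]mulr1 addr0 scale0r addr0 [x + _]addrC.
apply: DeriveDef.
  by move: hder; rewrite /derivable /= E.
by rewrite -hval /derive /= E.
Qed.

Lemma is_derive_scale_dir f x v (c d : R) :
  is_derive x v f d -> is_derive x (c *: v) f (c * d).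
Proof.
move=> hf; apply: is_derive_line0.
have -> : (fun t => f (x + t *: (c *: v))) =
    (fun t => f (x + t *: v)) \o (fun t : R => 0 + t * c).
  by apply/funext => t /=; rewrite add0r scalerA.
rewrite mulrC; apply: is_derive1_comp; last exact: is_derive_affine.
by rewrite mul0r addr0; apply: is_derive_line; rewrite scale0r addr0.
Qed.

Lemma continuous_plane_near f x v w e : {for x, continuous f} -> 0 < e ->
  exists2 r, 0 < r & forall s t, `|s| <= r -> `|t| <= r ->
    `|f (x + s *: v + t *: w) - f x| < e.
Proof.
move=> cf e0; have : \forall y \near x, `|f x - f y| < e.
  by move: cf => /cvgrPdist_lt; apply.
move=> /nbhs_ballP[r /= r0 hr].
(* The summand 1 keeps k positive when v = w = 0. *)
pose k := `|v| + `|w| + 1.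
have k0 : 0 < k by rewrite ltr_wpDl // addr_ge0.
exists (r / (2 * k)) => [|s t sr tr]; first by rewrite divr_gt0 // mulr_gt0.
rewrite distrC; apply: hr; rewrite -ball_normE /ball_ /= -addrA opprD addNKr normrN.
apply: (le_lt_trans (ler_normD _ _)); rewrite !normrZ.
have h1 : `|s| * `|v| <= r / (2 * k) * `|v| by rewrite ler_wpM2r.
have h2 : `|t| * `|w| <= r / (2 * k) * `|w| by rewrite ler_wpM2r.
apply: (le_lt_trans (lerD h1 h2)); rewrite -mulrDr.
have -> : r / (2 * k) * (`|v| + `|w|) = r * ((k - 1) / (2 * k)).
  by rewrite /k; field; rewrite -/k; lra.
rewrite gtr_pMr // ltr_pdivrMr ?mulr_gt0 //; lra.
Qed.

(** Directional derivatives alone are not additive in the direction. Continuity of b repairs this: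
    on the leg from x + h v to x + h v + h w the mean value theorem evaluates b at a point close to
    x. *)
Lemma is_derive_add_dir f x v w (a b : V -> R) :
    (forall y, is_derive y v f (a y)) -> (forall y, is_derive y w f (b y)) ->
    {for x, continuous b} ->
  is_derive x (v + w) f (a x + b x).
Proof.
move=> ha hb cb.
have key : (fun h : R => h^-1 *: (f (h *: (v + w) + x) - f x)) @ 0^' --> a x + b x.
  have -> : (fun h : R => h^-1 *: (f (h *: (v + w) + x) - f x)) =
      (fun h => h^-1 *: (f (h *: v + x) - f x)
        + h^-1 *: (f (h *: w + (h *: v + x)) - f (h *: v + x))).
    apply/funext => h; rewrite -scalerDr; congr (_ *: _).
    rewrite [RHS]addrC subrKA; congr (f _ - f x).
    by rewrite scalerDr addrCA addrA.
  apply: cvgD; first by have [hder <-] := ha x; exact: hder.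
  apply/cvgrPdist_lt => e e0.
  have [r r0 hr] := continuous_plane_near _ _ v w _ cb e0.
  near=> h.
  have h0 : h != 0 by near: h; exact: nbhs_dnbhs_neq.
  have hle : `|h| <= r.
    near: h; apply: dnbhs0_le => //.
  have hl (s : R) : is_derive s 1 (fun t => f ((h *: v + x) + t *: w))
      (b ((h *: v + x) + s *: w)) by apply: is_derive_line.
  have [c] := MVT_between _ _ 0 h hl; rewrite !subr0 scale0r addr0 => ch E.
  rewrite [h *: w + _]addrC E [_ *: _]mulrC mulfK // distrC [h *: v + x]addrC.
  by apply: hr => //; exact: le_trans hle.
apply: DeriveDef; first by apply/cvg_ex; exists (a x + b x).
exact/cvg_lim.
Unshelve. all: by end_near.
Qed.

Lemma second_difference f x v w (a c : V -> R) (h : R) :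
    (forall y, is_derive y v f (a y)) -> (forall y, is_derive y w a (c y)) ->
  exists s t, [/\ `|s| <= `|h|, `|t| <= `|h| &
    f (x + h *: v + h *: w) - f (x + h *: v) - f (x + h *: w) + f x
      = c (x + s *: v + t *: w) * h * h].
Proof.
move=> hf ha.
have hg (s : R) : is_derive s 1 (fun s => f (x + h *: w + s *: v) - f (x + s *: v))
    (a (x + h *: w + s *: v) - a (x + s *: v)).
  by apply: is_derive_subr; apply: is_derive_line.
have [s] := MVT_between _ _ 0 h hg; rewrite !subr0 !scale0r !addr0 => sh E.
have hk (t : R) : is_derive t 1 (fun t => a (x + s *: v + t *: w)) (c (x + s *: v + t *: w)).
  exact: is_derive_line.
have [t] := MVT_between _ _ 0 h hk; rewrite !subr0 !scale0r !addr0 => th E'.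
exists s, t; split => //; rewrite -E' (addrAC x (s *: v)) -E.
by rewrite (addrAC x (h *: v)); ring.
Qed.

(** The second difference is symmetric in v and w; the mean value theorem in the two orders makes c
    and d agree at points arbitrarily close to x. *)
Lemma schwarz f x v w (a b c d : V -> R) :
    (forall y, is_derive y v f (a y)) -> (forall y, is_derive y w f (b y)) ->
    (forall y, is_derive y w a (c y)) -> (forall y, is_derive y v b (d y)) ->
    {for x, continuous c} -> {for x, continuous d} ->
  c x = d x.
Proof.
move=> ha hb hc hd cc cd; apply/eqP; rewrite -subr_eq0 -normr_le0.
apply/ler_addgt0Pl => e e0; rewrite addr0.
have e2 : 0 < e / 2 by rewrite divr_gt0.
have [r r0 hr] := continuous_plane_near _ _ v w _ cc e2.
have [q q0 hq] := continuous_plane_near _ _ w v _ cd e2.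
pose h := Num.min r q.
have h0 : 0 < h by rewrite lt_min r0.
have hn : `|h| = h by rewrite gtr0_norm.
have [s [t [sh th E]]] := second_difference _ x v w _ _ h ha hc.
have [s' [t' [sh' th' E']]] := second_difference _ x w v _ _ h hb hd.
have EE : c (x + s *: v + t *: w) = d (x + s' *: w + t' *: v).
  have hh : h * h != 0 by rewrite mulf_neq0 // gt_eqF.
  apply: (mulIf hh); rewrite !mulrA -E -E' (addrAC x (h *: w)); ring.
have hhr : h <= r by rewrite ge_min lexx.
have hhq : h <= q by rewrite ge_min lexx orbT.
rewrite hn in sh th sh' th'.
have h1 := hr _ _ (le_trans sh hhr) (le_trans th hhr).
have h2 := hq _ _ (le_trans sh' hhq) (le_trans th' hhq).
rewrite EE distrC in h1.
have -> : c x - d x = (c x - d (x + s' *: w + t' *: v))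
   + (d (x + s' *: w + t' *: v) - d x) by ring.
rewrite (le_trans (ler_normD _ _)) // [e]splitr ltW // ltrD //.
Qed.

End Lines.

(** * Smooth convex functions *)

Section SmoothFunctions.
Context {R : realType} {n : nat}.
Implicit Types (u : 'rV[R]_n -> R) (x v e : 'rV[R]_n).

Lemma gradientE u x i : gradient u x 0 i = partial i u x.
Proof. by rewrite mxE. Qed.

Lemma smooth_partial u i : smooth u -> smooth (partial i u).
Proof. by move=> su k; have [_ /(_ i)[]] := su k.+1. Qed.

Lemma smooth_continuous u : smooth u -> continuous u.
Proof. by move=> su; have := su 0%N => -[]. Qed.

Lemma smooth_is_derive_partial u i x : smooth u ->
  is_derive x (delta_mx 0 i) u (partial i u x).
Proof. by move=> su; have [_ /(_ i)[h _]] := su 1%N; apply/derivableP/h. Qed.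

Lemma smooth_is_derive u x v : smooth u ->
  is_derive x v u (dot v (gradient u x)).
Proof.
move=> su.
suff H (r : seq 'I_n) y : is_derive y (\sum_(i <- r) v 0 i *: delta_mx 0 i) u
    (\sum_(i <- r) v 0 i * partial i u y).
  rewrite [X in is_derive _ X _ _]row_sum_delta.
  apply: (is_derive_eq (H (index_enum _) x)).
  by apply: eq_bigr => i _; rewrite mxE.
elim: r y => [|i r IH] y.
  by rewrite !big_nil; exact: is_derive0.
rewrite !big_cons addrC [X in is_derive _ _ _ X]addrC.
apply: (is_derive_add_dir u y _ _ (fun y => \sum_(i <- r) v 0 i * partial i u y)
   (fun y => v 0 i * partial i u y)) => [z|].
  by apply: is_derive_scale_dir; exact: smooth_is_derive_partial.
apply: continuous_mulr; first exact: continuous_cstr.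
by apply: smooth_continuous; exact: smooth_partial.
Qed.

Lemma partial_comm u i j x : smooth u ->
  partial i (partial j u) x = partial j (partial i u) x.
Proof.
move=> su.
apply: (schwarz u x (delta_mx 0 j) (delta_mx 0 i)
  (partial j u) (partial i u)) => [y|y|y|y||];
  try by apply: smooth_is_derive_partial; do ?exact: smooth_partial.
- by apply: smooth_continuous; do 2 apply: smooth_partial.
- by apply: smooth_continuous; do 2 apply: smooth_partial.
Qed.

Lemma hessian_sym u x : smooth u -> (hessian u x)^T = hessian u x.
Proof. by move=> su; apply/matrixP => i j; rewrite !mxE partial_comm. Qed.

Lemma is_derive_gradient_line u x v (s : R) : smooth u ->
  is_derive s 1 (fun t => u (x + t *: v)) (dot v (gradient u (x + s *: v))).
Proof. by move=> su; apply: is_derive_line; exact: smooth_is_derive. Qed.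

Lemma is_derive_dot_gradient u x v e : smooth u ->
  is_derive x v (fun y => dot e (gradient u y)) (dot (v *m hessian u x) e).
Proof.
move=> su; apply: is_derive_eq.
  apply: is_derive_sumr => i; under eq_fun do rewrite mxE.
  by apply: is_derive_scaler; apply: smooth_is_derive; exact: smooth_partial.
apply: eq_bigr => i _; rewrite mulrC; congr (_ * _).
by rewrite [RHS]mxE; apply: eq_bigr => j _; rewrite !mxE.
Qed.

(** The third derivative D^3 u with one slot filled by e. *)
Definition dhessian u x e : 'M[R]_n :=
  \matrix_(i, j) dot e (gradient (partial i (partial j u)) x).

Lemma is_derive_hessian u x v i j : smooth u ->
  is_derive x v (fun y => hessian u y i j) (dhessian u x v i j).
Proof.
move=> su; under eq_fun do rewrite mxE.
by rewrite mxE; apply: smooth_is_derive; do 2 apply: smooth_partial.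
Qed.

(** Exchanges the slot of the last derivative with one of the Hessian; with the symmetry of the
    matrix this makes D^3 u a symmetric trilinear form. *)
Lemma dhessian_swap u x e v w : smooth u ->
  dot (v *m dhessian u x e) w = dot (e *m dhessian u x v) w.
Proof.
move=> su; apply: eq_bigr => j _; congr (_ * _); rewrite mxE [RHS]mxE.
under eq_bigr do rewrite mxE mulr_sumr.
under [RHS]eq_bigr do rewrite mxE mulr_sumr.
rewrite exchange_big /=; apply: eq_bigr => i _; apply: eq_bigr => k _.
rewrite mulrCA; congr (_ * (_ * _)).
apply: (etrans (gradientE _ _ _)); apply: (etrans _ (esym (gradientE _ _ _))).
exact: (partial_comm (partial j u) i k x (smooth_partial u j su)).
Qed.

Lemma is_derive_hessian_form u x v w e : smooth u ->
  is_derive x v (fun y => dot (w *m hessian u y) e) (dot (w *m dhessian u x v) e).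
Proof.
move=> su; apply: is_derive_eq.
  apply: is_derive_sumr => j; under eq_fun do rewrite mxE mulrC.
  apply: is_derive_scaler; apply: is_derive_sumr => i.
  by apply: is_derive_scaler; exact: is_derive_hessian.
by apply: eq_bigr => j _; rewrite mulrC [in RHS]mxE.
Qed.

Lemma continuous_gradient u i : smooth u -> continuous (fun x => gradient u x 0 i).
Proof.
move=> su; under eq_fun do rewrite mxE.
by apply: smooth_continuous; exact: smooth_partial.
Qed.

Lemma continuous_hessian u i j : smooth u -> continuous (fun x => hessian u x i j).
Proof.
move=> su; under eq_fun do rewrite mxE.
by apply: smooth_continuous; do 2 apply: smooth_partial.
Qed.

Section Convex.
Variable u : 'rV[R]_n -> R.
Hypotheses (su : smooth u) (cu : strictly_convex u).

Lemma hessian_gt0 x v : v != 0 -> 0 < dot (v *m hessian u x) v.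
Proof. by move=> /(cu x); rewrite -dotE. Qed.

Lemma hessian_psd x : psd (hessian u x).
Proof.
move=> v; have [->|v0] := eqVneq v 0; first by rewrite dot0r.
by rewrite ltW // hessian_gt0.
Qed.

Lemma slope_increasing x v (s t : R) : v != 0 -> s < t ->
  dot v (gradient u (x + s *: v)) < dot v (gradient u (x + t *: v)).
Proof.
move=> v0 st.
have hg (r : R) : is_derive r 1 (fun r => dot v (gradient u (x + r *: v)))
    (dot (v *m hessian u (x + r *: v)) v).
  apply: (is_derive_line (fun y => dot v (gradient u y))).
  exact: is_derive_dot_gradient.
have [c _ E] := MVT st (fun r _ => hg r)
  (continuous_subspaceT (is_derive_continuous _ _ hg)).
by rewrite -subr_gt0 E mulr_gt0 ?hessian_gt0 // subr_gt0.
Qed.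

Lemma gradient_lt x y : x != y -> u x + dot (y - x) (gradient u x) < u y.
Proof.
move=> xy; set v := y - x.
have v0 : v != 0 by rewrite subr_eq0 eq_sym.
have hu (r : R) : is_derive r 1 (fun r => u (x + r *: v))
    (dot v (gradient u (x + r *: v))) by exact: is_derive_gradient_line.
have [c] := MVT ltr01 (fun r _ => hu r)
  (continuous_subspaceT (is_derive_continuous _ _ hu)).
rewrite in_itv /= => /andP[c0 _].
rewrite scale1r scale0r addr0 subr0 mulr1 [x + v]addrC subrK => E.
rewrite -ltrBrDl E; have := slope_increasing x v 0 c v0 c0.
by rewrite scale0r addr0.
Qed.

Lemma gradient_le x y : u x + dot (y - x) (gradient u x) <= u y.
Proof.
have [->|xy] := eqVneq x y; last by rewrite ltW // gradient_lt.
by rewrite subrr dot0l addr0.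
Qed.

End Convex.

End SmoothFunctions.

(** * Continuity of the coefficients of determinants *)

Section PolyContinuity.
Context {R : realType} {T : topologicalType}.
Implicit Types p q : T -> {poly R}.

Definition poly_continuous p := forall k, continuous (fun t => (p t)`_k).

Lemma poly_continuous_mul p q :
  poly_continuous p -> poly_continuous q -> poly_continuous (fun t => p t * q t).
Proof.
move=> cp cq k; under eq_fun do rewrite coefM.
by apply: continuous_sumr => i; apply: continuous_mulr; [exact: cp | exact: cq].
Qed.

Lemma poly_continuous_cst (c : {poly R}) : poly_continuous (fun=> c).
Proof. by move=> k; exact: continuous_cstr. Qed.

Lemma poly_continuous_det n (A : T -> 'M[{poly R}]_n) :
  (forall i j, poly_continuous (fun t => A t i j)) -> poly_continuous (fun t => \det (A t)).
Proof.
move=> cA k; under eq_fun do rewrite coef_sum.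
apply: continuous_sumr => s; apply: (poly_continuous_mul (fun=> _)).
  exact: poly_continuous_cst.
elim: (index_enum _) => [|i r IH] l.
  by under eq_fun do rewrite big_nil; exact: poly_continuous_cst.
under eq_fun do rewrite big_cons.
exact: (poly_continuous_mul _ _ (cA i (s i)) IH).
Qed.

Lemma poly_continuous_cofactor n (A : T -> 'M[{poly R}]_n) i j :
  (forall i j, poly_continuous (fun t => A t i j)) ->
  poly_continuous (fun t => cofactor (A t) i j).
Proof.
move=> cA; apply: (poly_continuous_mul (fun=> _)).
  exact: poly_continuous_cst.
apply: poly_continuous_det => a b k; under eq_fun do rewrite !mxE.
exact: cA.
Qed.

Lemma poly_continuous_pencil n (B : T -> 'M[R]_n) :
    (forall i j, continuous (fun t => B t i j)) ->
  forall i j, poly_continuous (fun t => pencil (B t) i j).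
Proof.
move=> cB i j k; under eq_fun do rewrite !mxE coefD coefXM coefC.
apply: continuous_addr; first exact: continuous_cstr.
case: k => [|k] /=; first exact: continuous_cstr.
by case: k => [|k] /=; [exact: cB | exact: continuous_cstr].
Qed.

End PolyContinuity.

Lemma is_derive_ln_ratio {R : realType} (f g : R -> R) (s df dg : R) :
    is_derive s 1 f df -> is_derive s 1 g dg -> 0 < f s -> 0 < g s ->
  is_derive s 1 (fun t => ln (f t / g t)) (df / f s - dg / g s).
Proof.
move=> hf hg f0 g0.
have hgV : is_derive s 1 (fun t => (g t)^-1) (- (g s) ^- 2 * dg).
  by apply: is_deriveV => //; rewrite gt_eqF.
have hq := is_derive_mulr _ _ _ _ _ _ hf hgV.
have hl := is_derive1_ln (divr_gt0 f0 g0).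
have h := @is_derive1_comp R (@ln R) (fun t => f t / g t) s _ _ hl hq.
have -> : df / f s - dg / g s =
    (f s / g s)^-1 * (f s * (- g s ^- 2 * dg) + (g s)^-1 * df); last exact: h.
by field; rewrite !gt_eqF.
Qed.

(** * Linearization of the Hessian quotient along u *)

Section HessianQuotient.
Context {R : realType} {n : nat}.
Variables (n1 n2 : nat) (u : 'rV[R]_n -> R).
Hypotheses (n21 : (n2 < n1)%N) (n1n : (n1 <= n)%N).
Hypotheses (su : smooth u) (cu : strictly_convex u).

Definition hess_op x (M : 'M[R]_n) : R := linop n1 n2 (hessian u x) M.

Lemma pencil_hessian_gt0 x : 0 < (\det (pencil (hessian u x)))`_n1 /\
   0 < (\det (pencil (hessian u x)))`_n2.
Proof.
by have [] := linop_diag n1 n2 n21 n1n _ (hessian_sym u x su) (cu x).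
Qed.

Lemma is_derive_ln_q x v :
  is_derive x v (fun y => ln (q n1 n2 (hessian u y))) (hess_op x (dhessian u x v)).
Proof.
apply: is_derive_line0.
have -> : (fun t : R => ln (q n1 n2 (hessian u (x + t *: v)))) =
  (fun t => ln ((\det (pencil (hessian u (x + t *: v))))`_n1
              / (\det (pencil (hessian u (x + t *: v))))`_n2)).
  by apply/funext => t; rewrite /q !sigma_pencil //; exact: hessian_sym.
rewrite /hess_op linopE.
have hd l : is_derive (0 : R) 1 (fun t => (\det (pencil (hessian u (x + t *: v))))`_l)
    (dsigma l (hessian u x) (dhessian u x v)).
  have h := is_derive_det_pencil (R := R) _ (fun t : R => hessian u (x + t *: v))
    (dhessian u x v) (0 : R) 1 l.
  rewrite scale0r addr0 in h; apply: h => i j.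
  apply: (is_derive_line (fun y => hessian u y i j)).
  by rewrite scale0r addr0; exact: is_derive_hessian.
have [p1 p2] := pencil_hessian_gt0 x.
have E : x + (0 : R) *: v = x by rewrite scale0r addr0.
have := is_derive_ln_ratio _ _ _ _ _ (hd n1) (hd n2).
by rewrite E; apply.
Qed.

(** Continuity turns pointwise ellipticity into uniform bounds on compact sets. *)
Lemma continuous_lin_coef i j :
  continuous (fun x => lin_coef n1 n2 (hessian u x) i j).
Proof.
have cP := poly_continuous_pencil _ (hessian u) (fun i j => continuous_hessian u i j su).
have cC : poly_continuous (fun x => 'X * cofactor (pencil (hessian u x)) i j).
  apply: (poly_continuous_mul (fun=> _)); first exact: poly_continuous_cst.
  exact: poly_continuous_cofactor.
have cD : poly_continuous (fun x => \det (pencil (hessian u x))).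
  exact: poly_continuous_det.
rewrite /lin_coef; apply: continuous_addr; last apply: continuous_oppr.
- apply: continuous_mulr; first exact: cC.
  apply: continuous_invr => [x|]; last exact: cD.
  by rewrite gt_eqF //; have [] := pencil_hessian_gt0 x.
- apply: continuous_mulr; first exact: cC.
  apply: continuous_invr => [x|]; last exact: cD.
  by rewrite gt_eqF //; have [] := pencil_hessian_gt0 x.
Qed.

Lemma hess_opD x M N : hess_op x (M + N) = hess_op x M + hess_op x N.
Proof. exact: linopD. Qed.

Lemma hess_opZ x (a : R) M : hess_op x (a *: M) = a * hess_op x M.
Proof. exact: linopZ. Qed.

Lemma hess_op_le x M N : psd (N - M) -> hess_op x M <= hess_op x N.
Proof. by apply: linop_le => //; exact: hessian_sym. Qed.

Lemma hess_op_hessian x : hess_op x (hessian u x) = n1%:R - n2%:R.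
Proof. by apply: linop_self => //; exact: hessian_sym. Qed.

Lemma hess_op_rank1_gt0 x (v : 'rV[R]_n) : v != 0 -> 0 < hess_op x (v^T *m v).
Proof. by apply: linop_rank1_gt0 => //; exact: hessian_sym. Qed.

Lemma continuous_hess_op (M : 'rV[R]_n -> 'M[R]_n) :
    (forall i j, continuous (fun x => M x i j)) ->
  continuous (fun x => hess_op x (M x)).
Proof.
move=> cM; apply: continuous_sumr => i; apply: continuous_sumr => j.
by apply: continuous_mulr; [exact: cM | exact: continuous_lin_coef].
Qed.

End HessianQuotient.

(** * Maximum principle and coercivity *)

Section MaximumPrinciple.
Context {R : realType} {n : nat}.
Implicit Types (f : 'rV[R]_n -> R) (x v : 'rV[R]_n).

Lemma continuous_line x v : continuous (fun t : R => x + t *: v).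
Proof. by move=> t; apply: cvgD; [exact: cvg_cst | apply: cvgZr_tmp; exact: cvg_id]. Qed.

(** Only the quadratic form of H is tested, so H may contain nonsymmetric rank one terms a^T b; the
    monotonicity of F sees only the form as well. *)
Lemma local_max_gradient_hessian f (g : 'rV[R]_n -> 'rV[R]_n) (H : 'M[R]_n) x :
    (forall y v, is_derive y v f (dot v (g y))) ->
    (forall v, is_derive x v (fun y => dot v (g y)) (dot (v *m H) v)) ->
    (\forall y \near x, f y <= f x) ->
  g x = 0 /\ psd (- H).
Proof.
move=> hf hg xmax.
have test v : dot v (g x) = 0 /\ dot (v *m H) v <= 0.
  have hf' (s : R) : is_derive s 1 (fun t => f (x + t *: v)) (dot v (g (x + s *: v))).
    exact: is_derive_line.
  have hg' : is_derive (0 : R) 1 (fun t => dot v (g (x + t *: v))) (dot (v *m H) v).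
    by apply: (is_derive_line (fun y => dot v (g y))); rewrite scale0r addr0.
  have : \forall t \near (0 : R), f (x + t *: v) <= f x.
    have cl := @continuous_line x v 0; rewrite /continuous_at scale0r addr0 in cl.
    exact: (cl _ xmax).
  move=> /nbhs_ballP[e /= e0 he].
  have [|h1 h2] := local_max_derivatives _ _ _ _ hf' hg' e0.
    move=> s se; rewrite scale0r addr0; apply: he.
    by rewrite /ball /= sub0r normrN.
  by move: h1; rewrite scale0r addr0.
split.
  by apply/eqP; rewrite -dotxx_eq0; apply/eqP; exact: (test (g x)).1.
by move=> v; rewrite mulmxN dotNl oppr_ge0; exact: (test v).2.
Qed.

Definition coercive f := forall C : R, exists r : R, forall x, f x <= C -> dot x x <= r.

Lemma coercive_compact f C : continuous f -> coercive f -> compact [set x | f x <= C].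
Proof.
move=> cf /(_ C)[r hr]; apply: (@compact_dot_bounded _ _ _ r) => [x /hr //|].
exact: closed_le_fun.
Qed.

Lemma coercive_min f : continuous f -> coercive f -> exists x, forall y, f x <= f y.
Proof.
move=> cf kf.
have [|x _ hx] := EVT_min_rV _ (coercive_compact f (f 0) cf kf) (continuous_subspaceT cf).
  by exists 0 => /=.
exists x => y; have [fy|fy] := leP (f y) (f 0); first by apply: hx; rewrite inE.
by rewrite (le_trans _ (ltW fy)) //; apply: hx; rewrite inE /=.
Qed.

(** The tangent plane at y forces linear growth along every ray in a direction near e, beyond a
    common distance. Compactness of the unit sphere makes this distance uniform. *)
Lemma coercive_of_directions (u : 'rV[R]_n -> R) (p : 'rV[R]_n) :
    smooth u -> strictly_convex u ->
    (forall e, dot e e = 1 -> exists y, 0 < dot e (gradient u y - p)) ->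
  coercive (fun x => u x - dot x p).
Proof.
move=> su cu hdir C.
pose S := [set e : 'rV[R]_n | dot e e = 1].
have cdot (p' : 'rV[R]_n) : continuous (fun e : 'rV[R]_n => dot e p').
  apply: continuous_dot => i; first exact: coord_continuous_row.
  exact: continuous_cstr.
have cS : compact S.
  apply: (@compact_dot_bounded _ _ _ 1) => [x -> //|].
  apply: closed_eq_fun; apply: continuous_dot => i; exact: coord_continuous_row.
pose P (t : R) (e : 'rV[R]_n) := forall s, t <= s -> C < u (s *: e) - dot (s *: e) p.
have near_P e : S e -> \forall e' \near e & t \near +oo, P t e'.
  move=> /hdir[y hy].
  pose c := dot e (gradient u y - p).
  have c2 : c / 2 < c by rewrite /c; lra.
  pose K := u y - dot y (gradient u y).
  near=> e' t => s ts.
  have h1 : c / 2 < dot e' (gradient u y - p).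
    near: e'; exact: (cvgr_gt _ (cdot (gradient u y - p) e)).
  have t0 : 0 < t by near: t; exact: nbhs_pinfty_gt.
  have tK : (C - K) / (c / 2) < t by near: t; apply: nbhs_pinfty_gt; rewrite num_real.
  have h2 := gradient_le u su cu y (s *: e').
  have h3 : (C - K) < s * (c / 2).
    by rewrite -ltr_pdivrMr ?divr_gt0 // (lt_le_trans tK).
  have h4 : s * (c / 2) <= s * dot e' (gradient u y - p).
    by rewrite ler_pM2l ?ltW // (lt_le_trans t0).
  rewrite dotBl dotZl in h2; rewrite dotBr mulrBr in h4; rewrite dotZl.
  by rewrite /K in h3; lra.
have /compact_near_coveringP nc := cS.
have hP := nc R _ P _ near_P.
have [t [t0 ht]] : exists t, 0 < t /\ forall e, S e -> P t e.
  near (+oo : set_system R) => t; exists t; split.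
    by near: t; exact: nbhs_pinfty_gt.
  by near: t; exact: hP.
exists (t ^+ 2) => x xC.
rewrite leNgt; apply/negP => tx.
set s := Num.sqrt (dot x x).
have xx0 : 0 < dot x x by apply: lt_trans tx; rewrite exprn_gt0.
have s0 : 0 < s by rewrite sqrtr_gt0.
have s2 : s ^+ 2 = dot x x by rewrite sqr_sqrtr // ltW.
have ts : t <= s by rewrite -(@ler_pXn2r _ 2) ?nnegrE ?(ltW t0) ?(ltW s0) // s2 ltW.
have := ht (s^-1 *: x) _ s ts.
rewrite /S /= dotZl dotZr -s2 scalerA mulfV ?gt_eqF // scale1r.
have -> : s^-1 * (s^-1 * s ^+ 2) = 1 by field; rewrite gt_eqF.
by move=> /(_ erefl); rewrite ltNge xC.
Unshelve. all: by end_near.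
Qed.

End MaximumPrinciple.

(** * Self-shrinking solutions *)

Section QuadraticForms.
Context {R : realType} {n : nat}.
Implicit Types (x v w : 'rV[R]_n) (M : 'M[R]_n).

Lemma dot_rank1 v a b : dot (v *m (a^T *m b)) v = dot v a * dot v b.
Proof. by rewrite mulmxA [v *m a^T]mx11_scalar -dotE mul_scalar_mx dotZl (dotC b). Qed.

Lemma form_combination v (a b r s : 'rV[R]_n) (k k1 k2 : R) M N :
  dot (v *m (k *: (a^T *m b + k1 *: M - k2 *: (r^T *m s) - N))) v =
  k * (dot v a * dot v b + k1 * dot (v *m M) v - k2 * (dot v r * dot v s)
       - dot (v *m N) v).
Proof.
rewrite -scalemxAr dotZl !mulmxBr mulmxDr !dotBl dotDl -!scalemxAr !dotZl.
by rewrite !dot_rank1.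
Qed.

Lemma dotDZr v a b (c : R) : dot v (a + c *: b) = dot v a + c * dot v b.
Proof. by rewrite dotDr dotZr. Qed.

Lemma dot_symm M v w : M^T = M -> dot (v *m M) w = dot (w *m M) v.
Proof. by move=> Ms; rewrite dot_mul Ms dotC. Qed.

Lemma is_derive_coord x v i : is_derive x v (fun y => y 0 i) (v 0 i).
Proof.
apply: is_derive_line0; under eq_fun do rewrite !mxE.
exact: is_derive_affine.
Qed.

End QuadraticForms.

Section Soliton.
Context {R : realType} {n : nat}.
Variables (n1 n2 : nat) (u : 'rV[R]_n -> R).
Hypotheses (n21 : (n2 < n1)%N) (n1n : (n1 <= n)%N).
Hypotheses (su : smooth u) (cu : strictly_convex u).

(** * The phase and its derivatives *)

Definition phase x : R := 2^-1 * dot x (gradient u x) - u x.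

Definition phase_grad x : 'rV[R]_n := 2^-1 *: (x *m hessian u x - gradient u x).

Definition phase_hess x : 'M[R]_n := 2^-1 *: dhessian u x x.

Lemma hessian_dotC x v w :
  dot (v *m hessian u x) w = dot (w *m hessian u x) v.
Proof. by apply: dot_symm; exact: hessian_sym. Qed.

Lemma dhessian_dotC x e v w : dot (v *m dhessian u x e) w = dot (w *m dhessian u x e) v.
Proof.
apply: (is_derive_unique _ _ _ _ _ (is_derive_hessian_form u x e v w su)).
have -> : (fun y => dot (v *m hessian u y) w) = (fun y => dot (w *m hessian u y) v).
  by apply/funext => y; exact: hessian_dotC.
exact: is_derive_hessian_form.
Qed.

Lemma is_derive_phase x v : is_derive x v phase (dot v (phase_grad x)).
Proof.
have h i : is_derive x v (fun y => gradient u y 0 i) ((v *m hessian u x) 0 i).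
  have -> : (fun y => gradient u y 0 i) = (fun y => dot (delta_mx 0 i) (gradient u y)).
    by apply/funext => y; rewrite dotC dot_deltar.
  rewrite -[X in is_derive _ _ _ X]dot_deltar; exact: is_derive_dot_gradient.
have hd : is_derive x v (fun y => dot y (gradient u y))
    (dot x (v *m hessian u x) + dot v (gradient u x)).
  rewrite -[X in is_derive _ _ _ X]big_split; apply: is_derive_sumr => i.
  rewrite [v 0 i * _]mulrC.
  exact: (is_derive_mulr _ _ _ _ _ _ (is_derive_coord x v i) (h i)).
apply: (is_derive_eq (is_derive_subr _ _ _ _ _ _
  (is_derive_scaler 2^-1 _ _ _ _ hd) (smooth_is_derive u x v su))).
rewrite /phase_grad dotZr dotBr [dot x _]dotC hessian_dotC [dot (x *m _) v]dotC.
by field.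
Qed.

Lemma is_derive_phase_grad x v e :
  is_derive x v (fun y => dot e (phase_grad y)) (dot (v *m phase_hess x) e).
Proof.
have hd : is_derive x v (fun y => dot y (e *m hessian u y))
    (dot x (e *m dhessian u x v) + dot v (e *m hessian u x)).
  rewrite -[X in is_derive _ _ _ X]big_split; apply: is_derive_sumr => i.
  rewrite [v 0 i * _]mulrC.
  apply: is_derive_mulr; first exact: is_derive_coord.
  under eq_fun do rewrite -dot_deltar.
  rewrite -[X in is_derive _ _ _ X]dot_deltar; exact: is_derive_hessian_form.
have -> : (fun y => dot e (phase_grad y)) =
    (fun y => 2^-1 * (dot y (e *m hessian u y) - dot e (gradient u y))).
  apply/funext => y; rewrite /phase_grad dotZr dotBr.
  by rewrite dotC hessian_dotC dotC.
apply: (is_derive_eq (is_derive_scaler 2^-1 _ _ _ _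
  (is_derive_subr _ _ _ _ _ _ hd (is_derive_dot_gradient u x v e su)))).
rewrite /phase_hess -scalemxAr dotZl; congr (_ * _).
(* The two [hessian] terms cancel here; the symmetry of D^3 u then moves x into the slot of the
   derivative. *)
rewrite [dot v _]dotC [dot (e *m hessian u x) v]hessian_dotC addrK.
by rewrite dotC dhessian_swap // dhessian_dotC dhessian_swap // dhessian_dotC.
Qed.

Lemma continuous_phase : continuous phase.
Proof.
apply: continuous_addr; last by apply: continuous_oppr; exact: smooth_continuous.
apply: continuous_mulr; first exact: continuous_cstr.
apply: continuous_dot => i; first exact: coord_continuous_row.
exact: continuous_gradient.
Qed.

Hypothesis soliton : forall x, ln (q n1 n2 (hessian u x)) = phase x.

Let m : R := n1%:R - n2%:R.

Local Lemma m_gt0 : 0 < m.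
Proof. by rewrite subr_gt0 ltr_nat. Qed.

Local Notation L := (hess_op n1 n2 u).

Lemma op_dhessian x v : L x (dhessian u x v) = dot v (phase_grad x).
Proof.
have h := is_derive_ln_q n1 n2 u n21 n1n su cu x v.
have E : (fun y => ln (q n1 n2 (hessian u y))) = phase by apply/funext.
by rewrite E in h; exact: is_derive_unique h (is_derive_phase x v).
Qed.

Lemma op_phase_hess x : L x (phase_hess x) = 2^-1 * dot x (phase_grad x).
Proof. by rewrite hess_opZ op_dhessian. Qed.


(** * Coercivity of u *)

Lemma coercive_tangent p : p = gradient u 0 -> coercive (fun x => u x - dot x p).
Proof.
move=> ->; apply: coercive_of_directions => // e e1; exists e.
have e0 : e != 0 by rewrite -dotxx_eq0 e1 oner_neq0.
have := slope_increasing u su cu 0 e 0 1 e0 ltr01.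
by rewrite scale0r scale1r !add0r dotBr subr_gt0.
Qed.

(* The partial derivatives of u are eigenfunctions: [L (D^2 u_e) - x.Du_e / 2 = - u_e / 2]. *)
Lemma exists_uphill e : e != 0 -> exists y, 0 < dot e (gradient u y).
Proof.
move=> e0; apply/not_existsP => neg.
have {}neg y : dot e (gradient u y) <= 0 by rewrite leNgt; apply/negP; exact: neg.
pose f y := - dot e (gradient u y).
(* [neg] also holds at y + e, and the slope along e increases strictly. *)
have f_gt0 y : 0 < f y.
  rewrite oppr_gt0; have := slope_increasing u su cu y e 0 1 e0 ltr01.
  by rewrite scale0r addr0 => /lt_le_trans; apply; rewrite scale1r.
have cf : continuous f.
  apply: continuous_oppr; apply: continuous_dot => i; first exact: continuous_cstr.
  exact: continuous_gradient.
pose p := gradient u 0; pose w y := u y - u 0 - dot y p.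
have cw : continuous w.
  apply: continuous_addr.
    by apply: continuous_addr; [exact: smooth_continuous | exact: continuous_cstr].
  apply: continuous_oppr; apply: continuous_dot => i; first exact: coord_continuous_row.
  exact: continuous_cstr.
have kw : coercive w.
  move=> C; have [r hr] := coercive_tangent p erefl (C + u 0).
  by exists r => x xC; apply: hr; rewrite /w in xC; lra.
have w_ge0 y : 0 <= w y.
  have := gradient_le u su cu 0 y; rewrite subr0 -/p /w; lra.
have w0 : w 0 = 0 by rewrite /w dot0l !subrr.
(* Any minimum point of Q below satisfies w <= 2 m whatever eps is, so z can be fixed before eps is
   chosen. *)
have [z zK zmin] : exists2 z, z \in [set y | w y <= 2 * m] &
    forall t, t \in [set y | w y <= 2 * m] -> f z <= f t.
  apply: EVT_min_rV (continuous_subspaceT cf); last exact: coercive_compact.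
  by exists 0 => /=; rewrite w0 mulr_ge0 // ltW // m_gt0.
(* Makes the upper bound 2 eps m for f at the minimum of Q equal to f z / 2. *)
pose eps := f z / (4 * m).
have m0 := m_gt0.
have eps0 : 0 < eps by rewrite divr_gt0 // mulr_gt0.
pose Q y := eps * w y + f y.
have [x xmin] : exists x, forall y, Q x <= Q y.
  apply: coercive_min.
    apply: continuous_addr => //; apply: continuous_mulr => //; exact: continuous_cstr.
  move=> C; have [r hr] := kw (C / eps); exists r => y yC; apply: hr.
  rewrite ler_pdivlMr // mulrC (le_trans _ yC) // /Q lerDl ltW //.
have [| | |g0 gpsd] := local_max_gradient_hessian (fun y => - Q y)
    (fun y => e *m hessian u y - eps *: (gradient u y - p))
    (dhessian u x e - eps *: hessian u x) x.
- move=> y v.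
  have -> : (fun y => - Q y) = (fun y => dot e (gradient u y) - eps * (u y - u 0 - dot y p)).
    by apply/funext => y'; rewrite /Q /f /w; ring.
  rewrite dotBr dotZr [dot v (e *m _)]dotC hessian_dotC // dotBr.
  apply: is_derive_subr; first exact: is_derive_dot_gradient.
  apply: is_derive_scaler; apply: is_derive_subr.
    rewrite -[X in is_derive _ _ _ X]subr0; apply: is_derive_subr.
    exact: smooth_is_derive.
  apply: is_derive_sumr => i; rewrite mulrC.
  under eq_fun do rewrite mulrC.
  by apply: is_derive_scaler; exact: is_derive_coord.
- move=> v.
  have -> : (fun y => dot v (e *m hessian u y - eps *: (gradient u y - p))) =
     (fun y => dot (e *m hessian u y) v - eps * (dot v (gradient u y) - dot v p)).
    by apply/funext => y; rewrite dotBr dotZr dotBr [dot v (e *m _)]dotC.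
  rewrite mulmxBr -scalemxAr dotBl dotZl.
  rewrite -dhessian_swap //.
  apply: is_derive_subr.
    exact: is_derive_hessian_form.
  apply: is_derive_scaler; rewrite -[X in is_derive _ _ _ X]subr0.
  by apply: is_derive_subr; exact: is_derive_dot_gradient.
- by near=> y; rewrite lerN2.
have h1 : dot e (x *m hessian u x) = eps * dot x (gradient u x - p).
  have gE : e *m hessian u x = eps *: (gradient u x - p).
    by apply/eqP; rewrite -subr_eq0; apply/eqP.
  by rewrite dotC hessian_dotC // gE dotZl dotC.
have h2 : L x (dhessian u x e) <= eps * m.
  rewrite /m -(hess_op_hessian n1 n2 u n21 n1n su cu x) -hess_opZ; apply: hess_op_le => //.
  by move=> v; have := gpsd v; rewrite opprB.
have h3 : w x <= dot x (gradient u x - p).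
  have := gradient_le u su cu x 0; rewrite sub0r dotNl dotBr /w; lra.
rewrite op_dhessian /phase_grad dotZr dotBr h1 in h2.
have fE : dot e (gradient u x) = - f x by rewrite opprK.
rewrite fE opprK in h2.
(* Both terms on the left are nonnegative, so this single inequality bounds w x, which locates x,
   and f x, which contradicts the choice of z. *)
have h4 : f x + eps * dot x (gradient u x - p) <= 2 * eps * m by lra.
have h5 : w x <= 2 * m.
  rewrite -(ler_pM2l eps0); have : eps * w x <= eps * dot x (gradient u x - p).
    by rewrite ler_pM2l.
  by have := f_gt0 x; lra.
have h6 : f z <= f x by apply: zmin; rewrite inE.
have h7 : 0 <= eps * dot x (gradient u x - p).
  by apply: mulr_ge0; [exact: ltW | exact: le_trans (w_ge0 x) h3].
have h8 : 2 * eps * m = f z / 2 by rewrite /eps; field; rewrite gt_eqF.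
by have := f_gt0 z; lra.
Unshelve. all: by end_near.
Qed.

Lemma soliton_coercive : coercive u.
Proof.
have h : coercive (fun x => u x - dot x 0).
  apply: coercive_of_directions => // e e1.
  have e0 : e != 0 by rewrite -dotxx_eq0 e1 oner_neq0.
  by have [y hy] := exists_uphill e e0; exists y; rewrite subr0.
by move=> C; have [r hr] := h C; exists r => x xC; apply: hr; rewrite dot0r subr0.
Qed.


(** * The phase attains its maximum *)

Lemma op_gradient_bound y :
  L y ((y *m hessian u y)^T *m (y *m hessian u y)) <= dot (y *m hessian u y) y * m.
Proof.
rewrite /m -(hess_op_hessian n1 n2 u n21 n1n su cu y) -hess_opZ.
apply: hess_op_le => // v; rewrite mulmxBr dotBl -scalemxAr dotZl dot_rank1 subr_ge0.
rewrite [dot v _]dotC -expr2.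
exact: psd_cauchy_schwarz (hessian_sym u y su) (hessian_psd u cu y).
Qed.

(* [c tau Dphi = Du] and the semidefiniteness are the first and second order
   conditions at a maximum of [expR (c * phase y) * (T - u y)], with [tau = T - u y]. *)
Lemma critical_bound y (tau c : R) : 0 < tau -> c = (4 * m)^-1 ->
    (c * tau) *: phase_grad y = gradient u y ->
    psd (hessian u y + c *: ((gradient u y)^T *m phase_grad y)
         - (c * tau) *: phase_hess y) ->
  dot y (gradient u y) <= 4 * m.
Proof.
move=> tau0 cE gE hpsd; have m0 := m_gt0.
have c0 : 0 < c by rewrite cE invr_gt0 mulr_gt0.
set p := (c * tau)^-1.
have p0 : 0 < p by rewrite invr_gt0 mulr_gt0.
have pE : phase_grad y = p *: gradient u y.
  by rewrite -gE scalerA mulVf ?scale1r // gt_eqF // mulr_gt0.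
set X := dot y (gradient u y); pose F := L y ((gradient u y)^T *m gradient u y).
pose k := 1 + 2 * p.
have kE : y *m hessian u y = k *: gradient u y.
  have : 2 *: phase_grad y = y *m hessian u y - gradient u y.
    by rewrite /phase_grad scalerA divff ?scale1r // pnatr_eq0.
  rewrite pE scalerA => /eqP; rewrite eq_sym subr_eq => /eqP->.
  by rewrite /k scalerDl scale1r addrC.
have h1 : 2^-1 * X <= m + c * p * F.
  have := hess_op_le n1 n2 u n21 n1n su cu y _ _ hpsd.
  rewrite hess_opZ op_phase_hess hess_opD hess_op_hessian // hess_opZ pE dotZr -/X.
  rewrite -scalemxAr hess_opZ -/F mulrA.
  by have -> : c * tau * (2^-1 * (p * X)) = 2^-1 * X by rewrite /p; field; rewrite !gt_eqF.
have h2 : k ^+ 2 * F <= k * X * m.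
  have := op_gradient_bound y; rewrite kE dotZl [dot (gradient u y) y]dotC -/X.
  have -> : (k *: gradient u y)^T = k *: (gradient u y)^T.
    by apply/matrixP => i j; rewrite !mxE.
  by rewrite -scalemxAl -scalemxAr scalerA hess_opZ -/F expr2.
have F0 : 0 <= F.
  have -> : 0 = L y (0 *: (hessian u y)) by rewrite hess_opZ mul0r.
  apply: hess_op_le => // v; rewrite scale0r subr0 dot_rank1 -expr2; exact: sqr_ge0.
have k0 : 0 < k by rewrite /k; lra.
have h3 : k * F <= X * m by rewrite -(ler_pM2l k0) !mulrA -expr2.
(* No upper bound on p is known, since T - u may be small at y; the factor k = 1 + 2 p absorbs
   it. *)
have h4 : 2 * p * F <= k * F by rewrite ler_wpM2r // /k; lra.
have h5 : c * (p * F) <= c * (X * m / 2) by rewrite ler_pM2l //; lra.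
(* The size of c matters here: the rank one term costs X / 8 against X / 2 on the left, whence X <=
   8 m / 3. Any positive c below 1 / m would give some bound. *)
have h6 : c * (X * m / 2) = X / 8 by rewrite cE; field; rewrite gt_eqF.
by rewrite -mulrA in h1; lra.
Qed.

Lemma is_derive_expR_comp (f : 'rV[R]_n -> R) x v d : is_derive x v f d ->
  is_derive x v (fun y => expR (f y)) (expR (f x) * d).
Proof.
move=> hf; apply: is_derive_line0.
have hl : is_derive (0 : R) 1 (fun t => f (x + t *: v)) d.
  by apply: is_derive_line; rewrite scale0r addr0.
have := @is_derive1_comp R (@expR R) (fun t : R => f (x + t *: v)) 0 _ _ (is_derive_expR _) hl.
by rewrite scale0r addr0.
Qed.

Lemma continuous_expR_comp (f : 'rV[R]_n -> R) :
  continuous f -> continuous (fun y => expR (f y)).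
Proof. by move=> cf x; apply: continuous_comp; [exact: cf | exact: continuous_expR]. Qed.

Lemma barrier_max_bound (c T : R) y : c = (4 * m)^-1 -> u y < T ->
    (forall z, u z <= T ->
      expR (c * phase z) * (T - u z) <= expR (c * phase y) * (T - u y)) ->
  dot y (gradient u y) <= 4 * m.
Proof.
move=> cE uyT ymax; have tau0 : 0 < T - u y by rewrite subr_gt0.
pose E z := expR (c * phase z).
have hE x v : is_derive x v E (E x * (c * dot v (phase_grad x))).
  by apply: is_derive_expR_comp; apply: is_derive_scaler; exact: is_derive_phase.
have hT x v : is_derive x v (fun z => T - u z) (- dot v (gradient u x)).
  rewrite -[X in is_derive _ _ _ X]add0r.
  by apply: is_derive_subr; exact: smooth_is_derive.
(* The gradient of the maximised function with its positive factor [E z] removed. At y it vanishes,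
   which kills the first term of [H]. *)
pose g z := c * (T - u z) *: phase_grad z - gradient u z.
have ggE z v : dot v (g z) = c * (T - u z) * dot v (phase_grad z) - dot v (gradient u z).
  by rewrite /g dotBr dotZr.
pose H := E y *: ((c *: phase_grad y)^T *m g y + (c * (T - u y)) *: phase_hess y
   - c *: ((gradient u y)^T *m phase_grad y) - hessian u y).
have Ey0 : 0 < E y by exact: expR_gt0.
have [| | |g0 gpsd] := local_max_gradient_hessian (fun z => E z * (T - u z))
    (fun z => E z *: g z) H y.
- move=> z v; rewrite dotZr ggE.
  apply: (is_derive_eq (is_derive_mulr _ _ _ _ _ _ (hE z v) (hT z v))).
  by ring.
- move=> v.
  have hg : is_derive y v (fun z => dot v (g z))
     (c * ((T - u y) * dot (v *m phase_hess y) v - dot v (phase_grad y) * dot v (gradient u y))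
       - dot (v *m hessian u y) v).
    under eq_fun do rewrite ggE -mulrA.
    apply: is_derive_subr; last exact: is_derive_dot_gradient.
    apply: is_derive_scaler; rewrite -mulrN.
    exact: is_derive_mulr (hT y v) (is_derive_phase_grad y v v).
  under eq_fun do rewrite dotZr.
  apply: (is_derive_eq (is_derive_mulr _ _ _ _ _ _ (hE y v) hg)).
  by rewrite /H form_combination dotZr ggE; ring.
(* As u y < T, the maximum over the sublevel set is a local maximum in the whole space. *)
- have : \forall z \near y, u z < T.
    exact: (cvgr_lt _ (smooth_continuous u su y)).
  by apply: filterS => z zT; apply: ymax; exact: ltW.
have gy : g y = 0.
  by move/eqP: g0; rewrite scaler_eq0 gt_eqF //= => /eqP.
apply: (critical_bound y (T - u y) c) => //.
  by apply/eqP; rewrite -subr_eq0; apply/eqP.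
move=> v; have := gpsd v; rewrite /H gy mulmx0 add0r.
rewrite -scalerN -scalemxAr dotZl pmulr_rge0 //.
by rewrite !opprB addrA.
Qed.

Lemma phase_max : exists x0, forall x, phase x <= phase x0.
Proof.
have m0 := m_gt0; have ku := soliton_coercive; have cu' := smooth_continuous u su.
have [z zmin] := coercive_min u cu' ku.
have [x0 x0K x0max] : exists2 x0, x0 \in [set y | u y <= u 0 + 4 * m] &
    forall t, t \in [set y | u y <= u 0 + 4 * m] -> phase t <= phase x0.
  apply: EVT_max_rV (continuous_subspaceT continuous_phase); last exact: coercive_compact.
  by exists 0 => /=; rewrite lerDl mulr_ge0 // ltW.
exists x0 => x; rewrite leNgt; apply/negP => xx0.
pose c := (4 * m)^-1.
have c0 : 0 < c by rewrite invr_gt0 mulr_gt0.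
pose a := expR (c * phase x); pose b := expR (c * phase x0).
have ab : 0 < a - b by rewrite subr_gt0 ltr_expR ltr_pM2l.
(* T > D means exactly a (T - u x) > b (T - u z), since a > b; maximality of y gives the opposite
   inequality. *)
pose D := (a * u x - b * u z) / (a - b).
pose T := `|u x| + `|D| + 1.
have uxT : u x < T by have := ler_norm (u x); have := normr_ge0 D; rewrite /T; lra.
have DT : D < T by have := ler_norm D; have := normr_ge0 (u x); rewrite /T; lra.
pose f y := expR (c * phase y) * (T - u y).
have cf : continuous f.
  apply: continuous_mulr.
    apply: continuous_expR_comp; apply: continuous_mulr; first exact: continuous_cstr.
    exact: continuous_phase.
  by apply: continuous_addr; [exact: continuous_cstr | exact: continuous_oppr].
have [y yT ymax] : exists2 y, y \in [set y | u y <= T] &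
    forall t, t \in [set y | u y <= T] -> f t <= f y.
  apply: EVT_max_rV (continuous_subspaceT cf); last exact: coercive_compact.
  by exists x => /=; exact: ltW.
have fxy : f x <= f y by apply: ymax; rewrite inE /= ltW.
have fx0 : 0 < f x by rewrite mulr_gt0 ?expR_gt0 // subr_gt0.
have uyT : u y < T.
  by have := lt_le_trans fx0 fxy; rewrite /f pmulr_rgt0 ?expR_gt0 // subr_gt0.
have yX : dot y (gradient u y) <= 4 * m.
  by apply: (barrier_max_bound c T) => // t tT; apply: ymax; rewrite inE.
(* The tangent plane at y, evaluated at 0, gives u y <= u 0 + y.Du(y), so y lies in the set over
   which x0 maximises the phase. *)
have yK : phase y <= phase x0.
  apply: x0max; rewrite inE /=; have := gradient_le u su cu y 0.
  by rewrite sub0r dotNl; lra.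
have h1 : f y <= b * (T - u z).
  apply: (le_trans (y := b * (T - u y))).
    apply: ler_wpM2r; first by rewrite subr_ge0 ltW.
    by rewrite ler_expR ler_pM2l.
  by rewrite ler_pM2l ?expR_gt0 // lerB.
have h2 : a * (T - u x) <= b * (T - u z) by exact: le_trans h1.
by move: DT; rewrite /D ltr_pdivrMr //; lra.
Qed.


(** * Strong maximum principle for the phase *)

Lemma phase_constant : exists K, forall x, phase x = K.
Proof.
have [x0 x0max] := phase_max; exists (phase x0) => z; apply/eqP.
rewrite eq_le x0max /= leNgt; apply/negP => zx0.
(* Hopf's barrier exp(-alpha N) is centred at a point z where the phase is not maximal. Since x0 is
   a global maximum point, one ball around z containing x0 suffices, without a connectedness
   argument. *)
pose N y := dot (y - z) (y - z).
have cB i : continuous (fun y : 'rV[R]_n => (y - z) 0 i).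
  under eq_fun do rewrite !mxE.
  by apply: continuous_addr; [exact: coord_continuous_row | exact: continuous_cstr].
have cN : continuous N by exact: continuous_dot.
(* The summand 1 puts x0 strictly inside the ball; on the sphere E is then smaller than at x0, so f
   cannot be maximal there. *)
pose S := N x0 + 1.
pose A := [set y | N y <= S].
have cA : compact A.
  apply: (@compact_dot_bounded _ _ _ (2 * S + 2 * dot z z)); last exact: closed_le_fun.
  move=> x; rewrite /A /= /N => xS.
  (* Equivalent to |x|^2 <= 2 |x - z|^2 + 2 |z|^2. *)
  have := dotxx_ge0 (x - 2 *: z).
  by rewrite !(dotBl, dotBr, dotZl, dotZr) (dotC z x) in xS *; lra.
have x0A : A x0 by rewrite /A /= /S; lra.
(* Half of the gap keeps z out of K, so that y - z is nonzero and [a] positive on K. *)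
pose eta := (phase x0 - phase z) / 2.
have eta0 : 0 < eta by rewrite divr_gt0 // subr_gt0.
pose K := A `&` [set y | phase x0 - eta <= phase y].
have cK : compact K.
  by apply: compact_closedI => //; apply: closed_ge_fun; exact: continuous_phase.
have K0 : K !=set0 by exists x0; split => //=; rewrite lerBlDr lerDl ltW.
have Kz y : K y -> y - z != 0.
  move=> [_ /= hy]; apply/negP => /eqP/eqP; rewrite subr_eq0 => /eqP yz.
  by move: hy; rewrite yz /eta; lra.
pose a y := L y ((y - z)^T *m (y - z)).
(* For E = exp(-alpha N) one has L(D^2 E) - y.DE / 2 = alpha E (4 alpha a - b); [key] below makes E
   a strict subsolution on K. *)
pose b y := 2 * L y 1%:M - dot y (y - z).
have ca : continuous a.
  apply: (continuous_hess_op n1 n2 u n21 n1n su cu) => i j.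
  under eq_fun do rewrite mxE big_ord1 mxE.
  exact: continuous_mulr.
have cb : continuous b.
  apply: continuous_addr.
    apply: continuous_mulr; first exact: continuous_cstr.
    apply: (continuous_hess_op n1 n2 u n21 n1n su cu (fun=> 1%:M)) => i j.
    exact: continuous_cstr.
  apply: continuous_oppr; apply: continuous_dot => //.
  exact: coord_continuous_row.
have [ya yaK amin] := EVT_min_rV K0 cK (continuous_subspaceT ca).
have [yb ybK bmax] := EVT_max_rV K0 cK (continuous_subspaceT cb).
have a0 : 0 < a ya.
  by apply: hess_op_rank1_gt0 => //; apply: Kz; rewrite inE in yaK.
have aE y : a y = L y ((y - z)^T *m (y - z)) by [].
have bE y : b y = 2 * L y 1%:M - dot y (y - z) by [].
clearbody a b.
have [alpha alpha0 alphaE] : exists2 alpha, 0 < alpha & alpha * a ya = `|b yb| + 1.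
  by exists ((`|b yb| + 1) / a ya); rewrite ?divfK ?gt_eqF // divr_gt0 // ltr_wpDl.
have key y : K y -> b y < 4 * alpha * a y.
  move=> yK; have h1 : b y <= b yb by apply: bmax; rewrite inE.
  have h2 : a ya <= a y by apply: amin; rewrite inE.
  have h4 : alpha * a ya <= alpha * a y by rewrite ler_pM2l.
  have h5 := ler_norm (b yb); have h6 := normr_ge0 (b yb).
  by rewrite -mulrA; lra.
pose E y := expR (- alpha * N y).
have E0 y : 0 < E y by exact: expR_gt0.
have E1 y : E y <= 1.
  by rewrite -expR0 ler_expR mulNr oppr_le0 mulr_ge0 ?dotxx_ge0 // ltW.
pose f y := phase y + eta * E y.
have cf : continuous f.
  apply: continuous_addr; first exact: continuous_phase.
  apply: continuous_mulr; first exact: continuous_cstr.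
  apply: continuous_expR_comp; apply: continuous_mulr => //; exact: continuous_cstr.
have [x xA xmax] := EVT_max_rV (ex_intro _ x0 x0A) cA (continuous_subspaceT cf).
rewrite inE in xA.
have fx0 : f x0 <= f x by apply: xmax; rewrite inE.
(* f x >= f x0 > phase x0, while the barrier contributes at most eta. *)
have xK : K x.
  split => //=; move: fx0; rewrite /f.
  have h1 : 0 < eta * E x0 by rewrite mulr_gt0.
  have h2 : eta * E x <= eta by rewrite ler_piMr // ltW.
  lra.
have xS : N x < S.
  rewrite lt_neqAle xA andbT; apply/negP => /eqP NxS.
  have h1 : E x < E x0 by rewrite ltr_expR !mulNr ltrN2 ltr_pM2l // NxS /S; lra.
  have h2 : eta * E x < eta * E x0 by rewrite ltr_pM2l.
  by have h3 := x0max x; rewrite /f in fx0; lra.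
have hB y v w : is_derive y v (fun t => dot w (t - z)) (dot w v).
  apply: is_derive_sumr => i; apply: is_derive_scaler.
  under eq_fun do rewrite !mxE.
  rewrite -[X in is_derive _ _ _ X]addr0.
  by apply: is_derive_addr; exact: is_derive_coord.
have hN y v : is_derive y v N (2 * dot v (y - z)).
  have -> : 2 * dot v (y - z) = \sum_i ((y - z) 0 i * v 0 i + (y - z) 0 i * v 0 i).
    by rewrite big_split /= -/(dot (y - z) v) dotC; ring.
  apply: is_derive_sumr => i.
  have hi : is_derive y v (fun t => (t - z) 0 i) (v 0 i).
    under eq_fun do rewrite !mxE.
    rewrite -[X in is_derive _ _ _ X]addr0.
    by apply: is_derive_addr; exact: is_derive_coord.
  exact: (is_derive_mulr _ _ _ _ _ _ hi hi).
have hE y v : is_derive y v E (E y * (- alpha * (2 * dot v (y - z)))).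
  by apply: is_derive_expR_comp; apply: is_derive_scaler; exact: hN.
pose k := - 2 * alpha * eta.
pose H := phase_hess x + (eta * E x) *:
  ((4 * alpha ^+ 2) *: ((x - z)^T *m (x - z)) - (2 * alpha) *: 1%:M).
have [| | |g0 gpsd] := local_max_gradient_hessian f
    (fun y => phase_grad y + (k * E y) *: (y - z)) H x.
- move=> y v; rewrite dotDZr.
  apply: (is_derive_eq (is_derive_addr _ _ _ _ _ _ (is_derive_phase y v)
    (is_derive_scaler eta _ _ _ _ (hE y v)))).
  by rewrite /k; ring.
- move=> v.
  have -> : (fun y => dot v (phase_grad y + (k * E y) *: (y - z))) =
      (fun y => dot v (phase_grad y) + k * (E y * dot v (y - z))).
    by apply/funext => y; rewrite dotDZr mulrA.
  apply: (is_derive_eq (is_derive_addr _ _ _ _ _ _ (is_derive_phase_grad x v v)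
    (is_derive_scaler k _ _ _ _ (is_derive_mulr _ _ _ _ _ _ (hE x v) (hB x v v))))).
  have formE (M : 'M[R]_n) (w : 'rV[R]_n) (c1 c2 c3 : R) :
      dot (v *m (M + c1 *: (c2 *: (w^T *m w) - c3 *: 1%:M))) v =
      dot (v *m M) v + c1 * (c2 * (dot v w * dot v w) - c3 * dot v v).
    rewrite mulmxDr dotDl -scalemxAr dotZl mulmxBr dotBl -!scalemxAr !dotZl.
    by rewrite dot_rank1 mulmx1.
  by rewrite /H formE /k; ring.
- have : \forall y \near x, N y < S by exact: (cvgr_lt _ (cN x)).
  by apply: filterS => y yS; apply: xmax; rewrite inE /A /= ltW.
have LH : L x H <= 0.
  have -> : 0 = L x (0 *: 1%:M) by rewrite hess_opZ mul0r.
  by apply: hess_op_le => //; rewrite scale0r sub0r.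
have pg : phase_grad x = - (k * E x) *: (x - z).
  by apply/eqP; rewrite scaleNr -subr_eq0 opprK; apply/eqP.
(* With D phi replaced by the first order condition, L H equals eta alpha E (4 alpha a - b),
   positive by [key]. *)
move: LH; rewrite /H hess_opD op_phase_hess pg dotZr hess_opZ hess_opD.
have opN (c : R) M : L x (- (c *: M)) = - c * L x M by rewrite -scaleNr hess_opZ.
rewrite opN hess_opZ -aE => LH.
have := key x xK; rewrite ltNge => /negP; apply.
have ee : 0 < eta * E x * alpha.
  by apply: mulr_gt0 => //; exact: mulr_gt0.
rewrite -(ler_pM2l ee) bE.
rewrite -subr_le0; apply: le_trans LH; rewrite le_eqVlt; apply/orP; left; apply/eqP.
by rewrite /k; field.
Qed.


(** * A constant phase forces a quadratic solution *)

Lemma soliton_quadratic_form :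
  exists K, forall x, u x = 2^-1 * dot (x *m hessian u 0) x - K.
Proof.
have [K phaseK] := phase_constant; exists K.
have pg0 x : phase_grad x = 0.
  apply/eqP; rewrite -dotxx_eq0; apply/eqP.
  apply: (is_derive_unique _ _ _ _ _ (is_derive_phase x (phase_grad x))).
  by have -> : phase = (fun=> K); [apply/funext | exact: is_derive_cstr].
have dhessian0 x i j : dhessian u x x i j = 0.
  have h : dot (delta_mx 0 i *m phase_hess x) (delta_mx 0 j) = 0.
    apply: (is_derive_unique _ _ _ _ _ (is_derive_phase_grad x (delta_mx 0 i) (delta_mx 0 j))).
    have -> : (fun y => dot (delta_mx 0 j) (phase_grad y)) = (fun=> 0).
      by apply/funext => y; rewrite pg0 dot0r.
    exact: is_derive_cstr.
  move: h; rewrite dot_deltar -rowE mxE /phase_hess mxE => /eqP.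
  by rewrite mulf_eq0 invr_eq0 pnatr_eq0 => /eqP.
(* At the point c x the vanishing third derivative is taken in the direction c x; as c > 0, it
   vanishes in the direction x of the ray too. The mean value theorem on the segment from 0 to x
   concludes. *)
have hessE x : hessian u x = hessian u 0.
  apply/matrixP => i j.
  have hd (s : R) : is_derive s 1 (fun t => hessian u (0 + t *: x) i j)
      (dhessian u (0 + s *: x) x i j).
    exact: (is_derive_line (fun y => hessian u y i j) _ _ _ _ (is_derive_hessian _ _ _ _ _ su)).
  have [c] := MVT ltr01 (fun s _ => hd s)
    (continuous_subspaceT (is_derive_continuous _ _ hd)).
  rewrite in_itv /= => /andP[c0 _].
  rewrite scale1r scale0r !add0r => E.
  apply/eqP; rewrite -subr_eq0 E; apply/eqP.
  have := dhessian0 (c *: x) i j; rewrite mxE dotZl => /eqP.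
  by rewrite mulf_eq0 gt_eqF //= => /eqP h; rewrite mxE h mul0r.
move=> x; have := phaseK x; rewrite /phase.
(* D phi = 0 reads Du = x D^2 u, so no second integration is needed. *)
have -> : gradient u x = x *m hessian u 0.
  have /eqP := pg0 x; rewrite /phase_grad scaler_eq0 invr_eq0 pnatr_eq0 /= subr_eq0.
  by rewrite hessE => /eqP.
by rewrite [dot (_ *m _) _]dotC; lra.
Qed.

End Soliton.

Lemma quadratic_form_quadratic {R : realType} {n : nat} (M : 'M[R]_n) (K : R)
    (u : 'rV[R]_n -> R) :
  (forall x, u x = dot (x *m M) x - K) -> quadratic u.
Proof.
move=> uE.
pose X (i : 'I_n) : mpoly.mpoly n R := mpoly.mpolyX R (mpoly.mnm1 i).
pose XX i j : mpoly.mpoly n R := mpoly.mpolyX R (mpoly.mnm_add (mpoly.mnm1 i) (mpoly.mnm1 j)).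
exists (\sum_j \sum_i M i j *: XX i j - mpoly.mpolyC n K); split.
  apply: (leq_trans (mpoly.msizeD_le _ _)); rewrite geq_max; apply/andP; split; last first.
    by rewrite mpoly.msizeN mpoly.msizeC; case: (K != 0).
  apply: (leq_trans (mpoly.msize_sum _ _ _)); apply/bigmax_leqP => j _.
  apply: (leq_trans (mpoly.msize_sum _ _ _)); apply/bigmax_leqP => i _.
  apply: (leq_trans (mpoly.msizeZ_le _ _)).
  by rewrite mpoly.msizeX mpoly.mdegD !mpoly.mdeg1.
move=> x; rewrite uE mpoly.mevalB mpoly.mevalC; congr (_ - _).
rewrite raddf_sum; apply: eq_bigr => j _ /=.
rewrite raddf_sum mxE mulr_suml; apply: eq_bigr => i _ /=.
rewrite mpoly.mevalZ /XX mpoly.mpolyXD mpoly.mevalM !mpoly.mevalXU; ring.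
Qed.

Theorem theorem1p1 (R : realType) (n n1 n2 : nat) (u : 'rV[R]_n -> R)
    (hn : (1 <= n)%N) (hn2n1 : (n2 < n1)%N) (hn1n : (n1 <= n)%N)
    (hsmooth : smooth u) (hconvex : strictly_convex u)
    (hsoliton : forall x : 'rV[R]_n,
      ln (q n1 n2 (hessian u x)) =
      2^-1 * (\sum_(i < n) x 0 i * gradient u x 0 i) - u x) :
  quadratic u.
Proof.
have sol x : ln (q n1 n2 (hessian u x)) = phase u x by exact: hsoliton.
have [K uE] := soliton_quadratic_form n1 n2 u hn2n1 hn1n hsmooth hconvex sol.
apply: (quadratic_form_quadratic (2^-1 *: hessian u 0) K) => x.
by rewrite uE -scalemxAr dotZl.
Qed.
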